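(* For the subdivision of orthogonality fans $\pi:\widehat\Phi=(\Gamma\oplus\check\Gamma)_0\to\Phi=(\Sigma\oplus\check\Sigma)_0$ induced by crepant subdivisions $(\boldsymbol\Gamma,\widehat g)\to(\boldsymbol\Sigma,g)$ and $(\check{\boldsymbol\Gamma},\widehat{\check g})\to(\check{\boldsymbol\Sigma},\check g)$ of Landau--Ginzburg data, there is a canonical filtered morphism that is a quasi-isomorphism on every filtered piece $F^\lambda$: $$\widehat{\mathscr C}^{\mathrm{dR},N;\Gamma,\check\Gamma}_\Phi(\check g,g)\ \simeq\ R\pi_*\widehat{\mathscr C}^{\mathrm{dR},N}_{\widehat\Phi}(\widehat{\check g},\widehat g).$$
   Context: **Stacky fans.** $M$, $N=M^\vee$ are dual lattices of finite rank. A stacky fan $\boldsymbol\Sigma=(\Sigma,\{b_\rho\})$ in $M$ is a finite rational fan of strongly convex cones with a nonzero lattice vector $b_\rho\in\rho\cap M$ on each ray $\rho$. Put $\Delta_c=\operatorname{Conv}(\{0\}\cup\{b_\rho:\rho\preceq c\})$ and $P_{\boldsymbol\Sigma}=\bigcup_{c\in\Sigma}\Delta_c$. It is stacky log-$\mathbb Q$-Gorenstein if for each $c$ there is a rational linear form $\psi_c$ on $\operatorname{span}c$ with $\psi_c(b_\rho)=1$ for all rays $\rho\preceq c$; these glue to the height function $\psi:|\Sigma|\to\mathbb R$. A toric Landau--Ginzburg datum $(\boldsymbol\Sigma,f)$ consists of a quasi-projective, stacky log-$\mathbb Q$-Gorenstein stacky fan with $P_{\boldsymbol\Sigma}$ convex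 and a Laurent polynomial $f\in\mathbb C[N]$ regular on $X_\Sigma$. $P_{f,\infty}=\operatorname{Conv}(\{0\}\cup\operatorname{Supp}f)$. A subdivision of stacky fans retains original stacky vectors and chooses nonzero lattice vectors on new rays; it is crepant if the new vectors have $\psi_{\boldsymbol\Sigma}=1$. A subdivision of data $(\boldsymbol\Gamma,\widehat f)\to(\boldsymbol\Sigma,f)$ is a subdivision of stacky fans with both sides toric Landau--Ginzburg data and $\widehat f=f$ as Laurent polynomials. **Standing setting.** $\boldsymbol\Sigma$ (in $M$, height $\psi$) and $\check{\boldsymbol\Sigma}$ (in $N$, height $\check\psi$) are the stacky fans of a mirror pair of toric Landau--Ginzburg data $(\boldsymbol\Sigma,f)$, $(\check{\boldsymbol\Sigma},\check f)$, i.e. with $P:=P_{\boldsymbol\Sigma}=P_{\check f,\infty}$ and $Q:=P_{\check{\boldsymbol\Sigma}}=P_{f,\infty}$; in particular $\langle P,Q\rangle\ge0$. $g=\sum_{v\in N}\xi_vy^v\in\mathbb C[N]$ and $\check g=\sum_{u\in M}\check\xi_ux^u\in\mathbb C[M]$ are height-one representatives of $Q$ and $P$: their supports lie on faces of $Q$, resp. $P$, not containing $0$, and $P_{g,\infty}=Q$, $P_{\check g,\infty}=P$. The orthogonality fan is $\Phi=(\Sigma\oplus\check\Sigma)_0=\{c\oplus\check c:c\in\Sigma,\ \check c\in\check\Sigma,\ \langle c,\check c\rangle=0\}$, cones written $\eta=(c,\check c)$, with projections $p_M:\Phi\to\Sigma$, $p_N:\Phi\to\check\Sigma$. The map $\pi$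 sends $(\gamma,\check\gamma)$ to the pair of smallest cones of $\Sigma$, $\check\Sigma$ containing $\gamma,\check\gamma$. **Sheaves on fans.** A finite fan is a finite topological space whose open sets are the subfans; a sheaf is a collection of stalks $\mathcal F_\eta=\Gamma(\langle\eta\rangle,\mathcal F)$, $\langle\eta\rangle=\{\gamma\preceq\eta\}$, with compatible restriction maps to faces. For an order-preserving $\phi$, $(R^q\phi_*\mathcal F)_\eta=H^q(\phi^{-1}\langle\eta\rangle,\mathcal F)$. **Toric face algebras.** $\mathbb C[c]^\Gamma=\bigoplus_{m\in c\cap M}\mathbb Cx^m$ with $x^m\star_\Gamma x^{m'}=x^{m+m'}$ if $m,m'$ lie in a common cone of $\Gamma|_c$, and $0$ otherwise; restriction to a face $d\preceq c$ fixes $x^m$ if $m\in d$ and kills it otherwise. This defines the sheaf $\mathscr S_\Sigma^\Gamma$ on $\Sigma$; similarly $\mathscr S_{\check\Sigma}^{\check\Gamma}$. Trivial subdivisions are omitted from notation ($\mathbb C[c]$ is then the semigroup algebra). **The complex.** $\widehat{\mathscr C}^{\mathrm{dR},N;\Gamma,\check\Gamma}_\Phi(\check g,g)$ has underlying sheaf $p_M^{-1}\mathscr S_\Sigma^\Gamma\otimes p_N^{-1}\mathscr S_{\check\Sigma}^{\check\Gamma}\otimes\bigwedge^\bullet N_{\mathbb C}$ (constant exterior factor), and at $\eta=(c,\check c)$ its differential is $$D(x^my^n\otimes\omega)=\sum_{u\in c\cap M}\check\xi_u(x^u\star_\Gamma x^m)y^n\otimes\iota_u\omega+\sum_{v\in\check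 c\cap N}\xi_vx^m(y^v\star_{\check\Gamma}y^n)\otimes(v\wedge\omega)+x^my^n\otimes(n\wedge\omega).$$ For $z=x^my^n\otimes\omega$ with $\omega\in\bigwedge^kN_{\mathbb C}$ put $a(z)=k+\psi(m)-\check\psi(n)$, $r(z)=\psi(m)+\check\psi(n)$; the cohomological degree is $\deg_N(z)=a(z)+r(z)=k+2\psi(m)$, and the decreasing filtration is $F^\lambda=\bigoplus_{a(z)\ge\lambda}\mathbb Cz$ stalkwise. $\widehat{\mathscr C}^{\mathrm{dR},N}_{\widehat\Phi}(\widehat{\check g},\widehat g)$ is the same construction on $\widehat\Phi$ from $\Gamma$, $\check\Gamma$, $\widehat{\check g}=\check g$, $\widehat g=g$ with trivial subdivisions. *)

(* Defs.v *)
From HB Require Import structures.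
From mathcomp Require Import all_boot all_order all_algebra finmap.
From mathcomp Require Import boolp classical_sets functions reals convex complex.
From mathcomp Require Import monalg.

Set Implicit Arguments.
Unset Strict Implicit.
Unset Printing Implicit Defensive.

Import Order.TTheory GRing.Theory Num.Theory.
Local Open Scope classical_set_scope.
Local Open Scope ring_scope.

(******************************************************************************)
(* Lattices, cones, fans.  The dual lattices M and N of rank d are both Z^d   *)
(* (dual bases), paired by the dot product; M_R and N_R are both R^d.         *)
(******************************************************************************)

Definition latv (R : realType) (d : nat) (m : 'rV[int]_d) : 'rV[R]_d :=
  map_mx intr m.

Definition ratv (R : realType) (d : nat) (q : 'rV[rat]_d) : 'rV[R]_d :=
  map_mx ratr q.

Definition pairing (R : realType) (d : nat) (x y : 'rV[R]_d) : R :=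
  (x *m y^T) 0 0.

Section Fans.
Variables (R : realType) (d : nat).
Implicit Types (c e rho : set 'rV[R]_d) (x y w : 'rV[R]_d).

Definition conv_hull (A : set 'rV[R]_d) : set 'rV[R]_d :=
  [set x | exists (n : nat) (p : 'I_n -> 'rV[R]_d) (a : 'I_n -> R),
     [/\ forall i, A (p i), forall i, 0 <= a i, \sum_i a i = 1 &
         x = \sum_i a i *: p i]].

Definition rational_cone c : Prop :=
  exists (n : nat) (s : 'I_n -> 'rV[int]_d),
    c = [set x | exists2 a : 'I_n -> R, (forall i, 0 <= a i) &
                   x = \sum_i a i *: latv R (s i)].

Definition strongly_convex c : Prop := forall x, c x -> c (- x) -> x = 0.

Definition face e c : Prop :=
  exists w, (forall x, c x -> 0 <= pairing w x) /\
            e = [set x | c x /\ pairing w x = 0].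

Definition is_ray rho : Prop :=
  exists2 v : 'rV[R]_d, v != 0 & rho = [set x | exists2 a, 0 <= a & x = a *: v].

Definition rays c : set (set 'rV[R]_d) :=
  [set rho | is_ray rho /\ face rho c].

Definition is_fan (F : {fset (set 'rV[R]_d)}) : Prop :=
  [/\ forall c, c \in F -> rational_cone c /\ strongly_convex c,
      forall c e, c \in F -> face e c -> e \in F &
      forall c c', c \in F -> c' \in F ->
        face (c `&` c') c /\ face (c `&` c') c'].

(* The values of svec off the rays of the fan are irrelevant. *)
Record stacky_fan := StackyFan {
  cones : {fset (set 'rV[R]_d)};
  svec : set 'rV[R]_d -> 'rV[int]_d;
  conesP : is_fan cones;
  svecP : forall rho, rho \in cones -> is_ray rho ->
            svec rho != 0 /\ rho (latv R (svec rho)) }.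

Implicit Types S G : stacky_fan.

Definition fsupport S : set 'rV[R]_d :=
  [set x | exists2 c, c \in cones S & c x].

Definition Delta S c : set 'rV[R]_d :=
  conv_hull ([set 0] `|` [set latv R (svec S rho) | rho in rays c]).

Definition Ppoly S : set 'rV[R]_d :=
  [set x | exists2 c, c \in cones S & Delta S c x].

(* A rational form on span c is given by a rational covector extending it. *)
Definition is_height_form S c (q : 'rV[rat]_d) : Prop :=
  forall rho, rays c rho -> pairing (ratv R q) (latv R (svec S rho)) = 1.

Definition log_Q_Gorenstein S : Prop :=
  forall c, c \in cones S -> exists q, is_height_form S c q.

(* The height function psi on the support (single-valued when S is            *)
(* log-Q-Gorenstein), extended by 0 off the support.                          *)
Definition height S x : R :=
  xget 0 [set r | exists c q, [/\ c \in cones S, c x, is_height_form S c q &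
                               r = pairing (ratv R q) x]].

(* Quasi-projectivity of the toric variety X_S in terms of its fan: there is  *)
(* a strictly convex piecewise linear support function, equal to l c on c.    *)
Definition quasi_projective S : Prop :=
  exists l : set 'rV[R]_d -> 'rV[rat]_d,
    forall c c', c \in cones S -> c' \in cones S -> forall x, c' x ->
      pairing (ratv R (l c)) x <= pairing (ratv R (l c')) x ?= iff (x \in c).

(******************************************************************************)
(* Laurent polynomials and toric Landau-Ginzburg data                         *)
(******************************************************************************)

Definition laurent := {malg R[i]['rV[int]_d]}.
Implicit Types f g : laurent.

Definition newton0 f : set 'rV[R]_d :=
  conv_hull ([set 0] `|` [set latv R v | v in [set v | v \in msupp f]]).

(* X_S is glued from the charts Spec C[c^dual /\ N], c in S. *)
Definition regular_on S f : Prop :=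
  forall c, c \in cones S -> forall v, v \in msupp f ->
    forall x, c x -> 0 <= pairing x (latv R v).

Definition LG_datum S f : Prop :=
  [/\ quasi_projective S, log_Q_Gorenstein S,
      convex_set (Ppoly S : set (convex_lmodType 'rV[R]_d)) &
      regular_on S f].

Definition mirror_pair S f S' f' : Prop :=
  [/\ LG_datum S f, LG_datum S' f',
      Ppoly S = newton0 f' & Ppoly S' = newton0 f].

Definition subdivision G S : Prop :=
  [/\ fsupport G = fsupport S,
      forall c, c \in cones G -> exists2 s, s \in cones S & c `<=` s &
      forall rho, rho \in cones S -> is_ray rho ->
        rho \in cones G /\ svec G rho = svec S rho].

Definition crepant G S : Prop :=
  forall rho, rho \in cones G -> is_ray rho -> rho \notin cones S ->
    height S (latv R (svec G rho)) = 1.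

Definition LG_subdivision G gh S g : Prop :=
  [/\ subdivision G S, LG_datum G gh, LG_datum S g & gh = g].

Definition polytope_face (F Q : set 'rV[R]_d) : Prop :=
  exists w (r : R), (forall x, Q x -> pairing w x <= r) /\
                    F = [set x | Q x /\ pairing w x = r].

Definition height_one_rep g (Q : set 'rV[R]_d) : Prop :=
  newton0 g = Q /\
  forall v, v \in msupp g ->
    exists2 F, polytope_face F Q & ~ F 0 /\ F (latv R v).

(******************************************************************************)
(* Orthogonality fans                                                         *)
(******************************************************************************)

Definition orthogonal c c' : Prop := forall x y, c x -> c' y -> pairing x y = 0.

(* The cone c (+) c' is recorded as the pair (c, c'). *)
Definition ofan S S' : finType :=
  {p : cones S * cones S' | `[< orthogonal (val p.1) (val p.2) >]}.

Definition pM S S' (eta : ofan S S') : set 'rV[R]_d := val (val eta).1.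
Definition pN S S' (eta : ofan S S') : set 'rV[R]_d := val (val eta).2.

Definition oface S S' : rel (ofan S S') := fun gam eta =>
  `[< face (pM gam) (pM eta) /\ face (pN gam) (pN eta) >].

Definition smallest_cone S c s : Prop :=
  [/\ s \in cones S, c `<=` s &
      forall s', s' \in cones S -> c `<=` s' -> s `<=` s'].

Definition is_subdivision_map S S' G G' (pi : ofan G G' -> ofan S S') : Prop :=
  forall eta, smallest_cone S (pM eta) (pM (pi eta)) /\
              smallest_cone S' (pN eta) (pN (pi eta)).

End Fans.

(******************************************************************************)
(* Filtered complexes of sheaves on a finite fan T with face relation le      *)
(* (le b a: b is a face of a).  A complex is graded by real degrees (the      *)
(* degrees below need not be integral), with differential of degree 1: its    *)
(* term of degree delta has stalk gr a delta, a subspace of stalk a, and      *)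
(* F^lambda is cut out by fil a lambda.  The map res a b is meaningful only   *)
(* for le b a.                                                                *)
(******************************************************************************)

Record fcx_sheaf (K : nzRingType) (R : realType) (T : finType) := FcxSheaf {
  stalk : T -> lmodType K;
  res : forall a b : T, stalk a -> stalk b;
  dif : forall a : T, stalk a -> stalk a;
  gr : forall a : T, R -> set (stalk a);
  fil : forall a : T, R -> set (stalk a) }.

Section FilteredComplexes.
Variables (K : nzRingType) (R : realType).

Definition subspace (V : lmodType K) (A : set V) : Prop :=
  A 0 /\ forall (k : K) x y, A x -> A y -> A (k *: x + y).

Record is_fcx_sheaf (T : finType) (le : rel T) (F : fcx_sheaf K R T) : Prop := {
  res_linear : forall a b, le b a -> linear (@res _ _ _ F a b);
  res_id : forall a (x : stalk F a), res a x = x;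
  res_comp : forall a b c (x : stalk F a), le b a -> le c b ->
               res c (res b x) = res c x;
  dif_linear : forall a, linear (@dif _ _ _ F a);
  dif_dif : forall a (x : stalk F a), dif (dif x) = 0;
  dif_res : forall a b (x : stalk F a), le b a -> dif (res b x) = res b (dif x);
  gr_subspace : forall a (del : R), subspace (@gr _ _ _ F a del);
  gr_res : forall a b (del : R) (x : stalk F a), le b a ->
             gr del x -> gr del (res b x);
  gr_dif : forall a (del : R) (x : stalk F a), gr del x -> gr (del + 1) (dif x);
  fil_subspace : forall a (lam : R), subspace (@fil _ _ _ F a lam);
  fil_decr : forall a (lam mu : R), lam <= mu ->
               @fil _ _ _ F a mu `<=` @fil _ _ _ F a lam;
  fil_res : forall a b (lam : R) (x : stalk F a), le b a ->
              fil lam x -> fil lam (res b x);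
  fil_dif : forall a (lam : R) (x : stalk F a), fil lam x -> fil lam (dif x) }.

Section Morphisms.
Variables (T : finType) (le : rel T) (F F' : fcx_sheaf K R T).

Record is_filtered_morphism (phi : forall a, stalk F a -> stalk F' a) : Prop := {
  mor_linear : forall a, linear (phi a);
  mor_res : forall a b (x : stalk F a), le b a ->
              phi b (res b x) = res b (phi a x);
  mor_dif : forall a (x : stalk F a), phi a (dif x) = dif (phi a x);
  mor_gr : forall a (del : R) (x : stalk F a), gr del x -> gr del (phi a x);
  mor_fil : forall a (lam : R) (x : stalk F a), fil lam x -> fil lam (phi a x) }.

Definition cocycle (E : fcx_sheaf K R T) (lam del : R) (a : T) : set (stalk E a) :=
  [set x | [/\ gr del x, fil lam x & dif x = 0]].

Definition coboundary (E : fcx_sheaf K R T) (lam del : R) (a : T) :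
    set (stalk E a) :=
  [set x | exists y : stalk E a, [/\ gr (del - 1) y, fil lam y & dif y = x]].

(* phi induces injections and surjections on the stalks of all cohomology     *)
(* sheaves of F^lambda.                                                       *)
Definition quasi_iso_on_fil (phi : forall a, stalk F a -> stalk F' a)
    (lam : R) : Prop :=
  forall (a : T) (del : R),
    (forall x, cocycle lam del x -> coboundary lam del (phi a x) ->
               coboundary lam del x) /\
    (forall y, cocycle lam del y ->
       exists2 x : stalk F a, cocycle lam del x &
         coboundary lam del (y - phi a x)).

End Morphisms.
End FilteredComplexes.

Definition dprod (K : nzRingType) (I : Type) (V : I -> lmodType K) : Type :=
  forall i, V i.

Section DependentProduct.
Variables (K : nzRingType) (I : Type) (V : I -> lmodType K).
Implicit Types f g h : dprod V.

HB.instance Definition _ := gen_eqMixin (dprod V).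
HB.instance Definition _ := gen_choiceMixin (dprod V).

Let zero : dprod V := fun i => 0.
Let opp f : dprod V := fun i => - f i.
Let add f g : dprod V := fun i => f i + g i.
Let scale (k : K) f : dprod V := fun i => k *: f i.

Fact dprod_addA : associative add.
Proof. by move=> f g h; apply: functional_extensionality_dep => i; rewrite /add addrA. Qed.
Fact dprod_addC : commutative add.
Proof. by move=> f g; apply: functional_extensionality_dep => i; rewrite /add addrC. Qed.
Fact dprod_add0 : left_id zero add.
Proof. by move=> f; apply: functional_extensionality_dep => i; rewrite /add add0r. Qed.
Fact dprod_addN : left_inverse zero opp add.
Proof. by move=> f; apply: functional_extensionality_dep => i; rewrite /add addNr. Qed.

HB.instance Definition _ := GRing.isZmodule.Build (dprod V)
  dprod_addA dprod_addC dprod_add0 dprod_addN.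

Fact dprod_scaleA a b f : scale a (scale b f) = scale (a * b) f.
Proof. by apply: functional_extensionality_dep => i; rewrite /scale scalerA. Qed.
Fact dprod_scale1 : left_id 1 scale.
Proof. by move=> f; apply: functional_extensionality_dep => i; rewrite /scale scale1r. Qed.
Fact dprod_scaleDr : right_distributive scale +%R.
Proof. by move=> k f g; apply: functional_extensionality_dep => i; rewrite /scale scalerDr. Qed.
Fact dprod_scaleDl f : {morph scale^~ f : a b / a + b}.
Proof. by move=> a b; apply: functional_extensionality_dep => i; rewrite /scale scalerDl. Qed.

HB.instance Definition _ := GRing.Zmodule_isLmodule.Build K (dprod V)
  dprod_scaleA dprod_scale1 dprod_scaleDr dprod_scaleDl.

End DependentProduct.

(******************************************************************************)
(* Derived push-forward along pi : T -> T'.  R pi_* F is pi_* of the Godement *)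
(* resolution of the complex F: its stalk at eta is the total complex of      *)
(*   prod_(g_0 >= ... >= g_p in pi^-1 <eta>) F_(g_p),   p = 0, 1, 2, ...      *)
(* which computes the hypercohomology of F on the open set pi^-1 <eta>.       *)
(******************************************************************************)

Section DerivedPushforward.
Variables (K : nzRingType) (R : realType).
Variables (T : finType) (le : rel T) (T' : finType) (le' : rel T').
Variable pi : T -> T'.

Definition is_chain (eta : T') (p : nat) (s : {ffun 'I_p.+1 -> T}) : bool :=
  [forall i, le' (pi (s i)) eta] &&
  [forall i : 'I_p.+1, forall j : 'I_p.+1, (i <= j)%N ==> le (s j) (s i)].

Definition chain (eta : T') (p : nat) : Type :=
  {s : {ffun 'I_p.+1 -> T} | is_chain eta s}.

Definition last_cone eta p (s : chain eta p) : T := val s ord_max.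

Fact chain_omit_subproof eta p (s : chain eta p.+1) (i : 'I_p.+2) :
  is_chain eta [ffun j : 'I_p.+1 => val s (lift i j)].
Proof.
have /andP[/forallP s_in /forallP s_le] := valP s.
apply/andP; split; apply/forallP => j; first by rewrite ffunE.
apply/forallP => k; apply/implyP => le_jk; rewrite !ffunE.
by have /forallP/(_ (lift i k))/implyP := s_le (lift i j); apply; rewrite leq_bump2.
Qed.

Definition chain_omit eta p (s : chain eta p.+1) (i : 'I_p.+2) : chain eta p :=
  Sub _ (chain_omit_subproof s i).

Variable F : fcx_sheaf K R T.

Definition Rpush_stalk (eta : T') : lmodType K :=
  dprod (fun p : nat => dprod (fun s : chain eta p => stalk F (last_cone s))).

(* Restriction to the chains in pi^-1 <eta'>; for eta' a face of eta they all *)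
(* are chains in pi^-1 <eta>, and the default value 0 is not used.            *)
Definition Rpush_res (eta eta' : T') (f : Rpush_stalk eta) : Rpush_stalk eta' :=
  fun p s => if insub (val s) is Some t
             then res (last_cone s) (f p t) else 0.

Definition Rpush_dif (eta : T') (f : Rpush_stalk eta) : Rpush_stalk eta :=
  fun p => match p with
  | 0 => fun s => dif (f 0%N s)
  | q.+1 => fun s =>
      \sum_(i < q.+2) (-1) ^+ i *: res (last_cone s) (f q (chain_omit s i))
      + (-1) ^+ q.+1 *: dif (f q.+1 s)
  end.

Definition Rpush_gr (eta : T') (del : R) : set (Rpush_stalk eta) :=
  [set f | forall p (s : chain eta p), gr (del - p%:R) (f p s)].

Definition Rpush_fil (eta : T') (lam : R) : set (Rpush_stalk eta) :=
  [set f | forall p (s : chain eta p), fil lam (f p s)].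

Definition Rpush : fcx_sheaf K R T' :=
  FcxSheaf Rpush_res Rpush_dif Rpush_gr Rpush_fil.

(* The canonical map from pi_* F to R pi_* F (the Godement augmentation). *)
Definition Rpush_aug (eta : T') (sec : forall gam : T, stalk F gam) :
    stalk Rpush eta :=
  fun p => match p return dprod (fun s : chain eta p => stalk F (last_cone s)) with
  | 0 => fun s => sec (last_cone s)
  | q.+1 => fun _ => 0
  end.

End DerivedPushforward.

(******************************************************************************)
(* The de Rham complexes                                                      *)
(******************************************************************************)

Section DeRham.
Variables (R : realType) (d : nat).
Implicit Types (c : set 'rV[R]_d) (m n u v : 'rV[int]_d) (I J : {set 'I_d}).

(* The exterior algebra of N_C: w I is the coefficient of w on                *)
(* e_I = e_(i_1) /\ ... /\ e_(i_k), where I = {i_1 < ... < i_k}.              *)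
Definition ext := {ffun {set 'I_d} -> R[i]}.

Definition ext_basis I : ext := [ffun J : {set 'I_d} => (J == I)%:R].

Definition ext_sign (i : 'I_d) J : R[i] :=
  (-1) ^+ #|[pred j in J | (j < i)%N]|.

Definition wedge v (w : ext) : ext :=
  [ffun J : {set 'I_d} =>
     \sum_(i : 'I_d | i \in J) ext_sign i J * (v 0 i)%:~R * w (J :\ i)].

Definition contract u (w : ext) : ext :=
  [ffun J : {set 'I_d} =>
     \sum_(i : 'I_d | i \notin J) ext_sign i J * (u 0 i)%:~R * w (i |: J)].

(* The monomials x^m y^n (x) e_I with m in c and n in c' form a basis of      *)
(* C[c] (x) C[c'] (x) /\N_C; the product structure of the toric face algebras *)
(* does not affect the underlying vector space.                               *)
Definition monomial c c' : choiceType :=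
  {z : 'rV[int]_d * 'rV[int]_d * {set 'I_d} |
     `[< c (latv R z.1.1) /\ c' (latv R z.1.2) >]}.

Definition face_tensor c c' : lmodType R[i] := {malg R[i][monomial c c']}.

(* The basis vector z of face_tensor c c', or 0 if it does not lie there. *)
Definition mono c c' (z : 'rV[int]_d * 'rV[int]_d * {set 'I_d}) :
    face_tensor c c' :=
  if insub z is Some z' then << (z' : monomial c c') >> else 0.

(* x^m y^n (x) w *)
Definition mono_ext c c' m n (w : ext) : face_tensor c c' :=
  \sum_(J : {set 'I_d}) w J *: mono c c' (m, n, J).

Definition lin_ext c c' (V : lmodType R[i])
    (h : 'rV[int]_d * 'rV[int]_d * {set 'I_d} -> V) (x : face_tensor c c') : V :=
  let y : {malg R[i][monomial c c']} := x in
  \sum_(z <- msupp y) y@_z *: h (val z).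

(* Fixes the monomials lying in c2, c2' and kills the others. *)
Definition truncate c c' c2 c2' : face_tensor c c' -> face_tensor c2 c2' :=
  lin_ext (mono c2 c2').

(* x^u and x^m have nonzero product x^(u + m) in C[c]^G. *)
Definition star_nonzero (G : stacky_fan R d) c u m : bool :=
  `[< exists2 gam, gam \in cones G &
        [/\ gam `<=` c, gam (latv R u) & gam (latv R m)] >].

Section Complex.
Variables (S S' G G' : stacky_fan R d) (gc g : laurent R d).

Definition dR_dif_mono c c' (z : 'rV[int]_d * 'rV[int]_d * {set 'I_d}) :
    face_tensor c c' :=
  let: (m, n, J) := z in
  let w := ext_basis J in
  \sum_(u <- msupp gc | (latv R u \in c) && star_nonzero G c u m)
     gc@_u *: mono_ext c c' (u + m) n (contract u w)
  + \sum_(v <- msupp g | (latv R v \in c') && star_nonzero G' c' v n)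
     g@_v *: mono_ext c c' m (v + n) (wedge v w)
  + mono_ext c c' m n (wedge n w).

Definition aweight (z : 'rV[int]_d * 'rV[int]_d * {set 'I_d}) : R :=
  #|z.2|%:R + height S (latv R z.1.1) - height S' (latv R z.1.2).

Definition rweight (z : 'rV[int]_d * 'rV[int]_d * {set 'I_d}) : R :=
  height S (latv R z.1.1) + height S' (latv R z.1.2).

Definition degN (z : 'rV[int]_d * 'rV[int]_d * {set 'I_d}) : R :=
  aweight z + rweight z.

(* The complex on the orthogonality fan of S and S', with products taken in   *)
(* the toric face algebras of the subdivisions G and G'.                      *)
Definition dR_complex : fcx_sheaf R[i] R (ofan S S') :=
  @FcxSheaf R[i] R (ofan S S')
    (fun eta => face_tensor (pM eta) (pN eta))
    (fun eta eta' => @truncate (pM eta) (pN eta) (pM eta') (pN eta'))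
    (fun eta => lin_ext (dR_dif_mono (pM eta) (pN eta)))
    (fun eta del => [set x : {malg R[i][monomial (pM eta) (pN eta)]} |
       forall z, z \in msupp x -> degN (val z) = del])
    (fun eta lam => [set x : {malg R[i][monomial (pM eta) (pN eta)]} |
       forall z, z \in msupp x -> lam <= aweight (val z)]).

End Complex.

(* On a monomial, the section over pi^-1 <eta> whose value at gam is that     *)
(* monomial if it lies in gam, and 0 otherwise.                               *)
Definition dR_canonical (S S' G G' : stacky_fan R d) (gc g gch gh : laurent R d)
    (pi : ofan G G' -> ofan S S') (eta : ofan S S')
    (x : stalk (dR_complex S S' G G' gc g) eta) :
    stalk (Rpush (@oface R d G G') (@oface R d S S') pi
             (dR_complex G G' G G' gch gh)) eta :=
  @Rpush_aug _ _ _ (@oface R d G G') _ (@oface R d S S') pi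
    (dR_complex G G' G G' gch gh) eta
    (fun gam : ofan G G' => truncate (pM gam) (pN gam) x).

End DeRham.

(* Main.v *)
From mathcomp Require Import all_boot all_order all_algebra finmap.
From mathcomp Require Import boolp classical_sets reals complex.
From mathcomp Require Import monalg zify lra ring.
Require Import Defs.

(******************************************************************************)
(* As a sheaf of vector spaces, the complex on the subdivided fan splits over *)
(* the monomials x^m y^n (x) e_I: the summand of a monomial is the constant   *)
(* sheaf on the cones containing (m, n), and over pi^-1 <eta> these cones     *)
(* form a poset with a least element.  Hence the rows of the Godement double  *)
(* complex, augmented by the stalk at eta, are exact: a row is contracted by  *)
(* appending to a chain the smallest cone containing the monomial.  This      *)
(* contraction acts coefficientwise, so it respects degrees and F^lambda, and *)
(* as degrees are nonnegative a homogeneous cochain has only finitely many    *)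
(* nonzero Cech components, which can be removed from the top one down.       *)
(* Crepancy enters through the equality of the height functions of the fans   *)
(* and their subdivisions, <P, Q> >= 0 through the orthogonality of the pairs *)
(* of smallest cones.                                                         *)
(******************************************************************************)

Set Implicit Arguments.
Unset Strict Implicit.
Unset Printing Implicit Defensive.

Import Order.TTheory GRing.Theory Num.Theory.
Local Open Scope classical_set_scope.
Local Open Scope ring_scope.

(** * Polyhedral cones *)

(** The morphism at [eta] sends an element to the family of its truncations to the cones of the
    subdivided fan inside [eta], followed by the Godement augmentation.

    It commutes with the differentials thanks to the toric face algebras. A cone of a fan meets
    every other cone of that fan in a face, and faces are extremal ([face_addP]); so a nonzero
    product of x^u and x^m that lands in a cone of the subdivision has both factors there.
    Truncation therefore neither loses nor creates terms ([star_restrict], [truncate_dR_dif]), and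
    the same argument covers restriction to faces of [eta].

    It respects degrees and filtration. Exponents of height-one representatives have height 1
    ([height_one]), so every term of D raises the degree by 1 and none lowers the weight a
    ([dR_complex_is_fcx_sheaf]); crepancy makes the heights before and after subdivision agree
    ([height_crepant]).

    The augmented rows are exact. For a monomial with exponents (m, n) in [eta], the cones of the
    subdivision that contain (m, n) have a least element, and it lies over a face of [eta]
    ([subdivision_smallest]). Constant coefficients on a poset with a least element have no higher
    cohomology; [cech_exact0_dR] and [cech_exactS_dR] carry this out one coefficient at a time,
    hence inside every F^lambda. Since degN = k + 2 psi(m) is nonnegative, [total_reduction] passes
    from rows to the total complex in finitely many steps, and [augmentation_quasi_iso] concludes.

    The map pi exists because the mirror condition makes the pairing nonnegative
    ([mirror_pairing_ge0]), which forces orthogonality to pass from a pair of cones to the smallest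
    cones around it ([orthogonal_smallest]). *)

Section Pairing.
Variables (R : realType) (d : nat).
Implicit Types (x y z : 'rV[R]_d).

Lemma pairingE x y : pairing x y = \sum_i x 0 i * y 0 i.
Proof. by rewrite /pairing mxE; apply: eq_bigr => i _; rewrite mxE. Qed.

Lemma pairingC x y : pairing x y = pairing y x.
Proof. by rewrite !pairingE; apply: eq_bigr => i _; rewrite mulrC. Qed.

Lemma pairingDl x y z : pairing (x + y) z = pairing x z + pairing y z.
Proof. by rewrite /pairing mulmxDl mxE. Qed.

Lemma pairingZl a x y : pairing (a *: x) y = a * pairing x y.
Proof. by rewrite /pairing -scalemxAl mxE. Qed.

Lemma pairingDr x y z : pairing x (y + z) = pairing x y + pairing x z.
Proof. by rewrite !(pairingC x) pairingDl. Qed.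

Lemma pairingZr a x y : pairing x (a *: y) = a * pairing x y.
Proof. by rewrite !(pairingC x) pairingZl. Qed.

Lemma pairing0r x : pairing x 0 = 0.
Proof. by rewrite -(scale0r 0) pairingZr mul0r. Qed.

Lemma pairingNr x y : pairing x (- y) = - pairing x y.
Proof. by rewrite -scaleN1r pairingZr mulN1r. Qed.

Lemma pairingBr x y z : pairing x (y - z) = pairing x y - pairing x z.
Proof. by rewrite pairingDr pairingNr. Qed.

Lemma pairingBl x y z : pairing (x - y) z = pairing x z - pairing y z.
Proof. by rewrite !(pairingC _ z) pairingBr. Qed.

Lemma pairing_sumr (n : nat) x (p : 'I_n -> 'rV[R]_d) :
  pairing x (\sum_i p i) = \sum_i pairing x (p i).
Proof.
elim: n p => [|n IH] p; first by rewrite !big_ord0 pairing0r.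
by rewrite !big_ord_recl pairingDr IH.
Qed.

Lemma pairing_self_gt0 x : x != 0 -> 0 < pairing x x.
Proof.
move=> x0; rewrite lt0r pairingE; apply/andP; split.
  apply: contra x0 => /eqP h; apply/eqP/rowP => i; rewrite mxE.
  have sq_ge0 j : predT j -> 0 <= x 0 j * x 0 j by rewrite -expr2 sqr_ge0.
  have /eqP := psumr_eq0P sq_ge0 h (isT : predT i).
  by rewrite mulf_eq0 orbb => /eqP.
by apply: sumr_ge0 => i _; rewrite -expr2 sqr_ge0.
Qed.

End Pairing.

(** * Finitely generated cones and Gordan's alternative *)

Section ConicHulls.
Variables (R : realType) (d : nat).
Local Notation V := 'rV[R]_d.
Implicit Types (s t : seq V) (x y v w : V).

(** Peeling off one generator at a time lets proofs run by induction on the list, without finite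
    sums. *)
Fixpoint conic s x : Prop :=
  if s is v :: s' then exists2 a : R, 0 <= a & conic s' (x - a *: v) else x = 0.

Lemma conic0 s : conic s 0.
Proof. by elim: s => //= v s IH; exists 0; rewrite // scale0r subr0. Qed.

Lemma conicD s x y : conic s x -> conic s y -> conic s (x + y).
Proof.
elim: s x y => [|v s IH] x y /=; first by move=> -> ->; rewrite addr0.
move=> [a a0 hx] [b b0 hy]; exists (a + b); first exact: addr_ge0.
by have := IH _ _ hx hy; rewrite scalerDl opprD addrACA.
Qed.

Lemma conicZ s a x : 0 <= a -> conic s x -> conic s (a *: x).
Proof.
move=> a0; elim: s x => [|v s IH] x /=; first by move=> ->; rewrite scaler0.
move=> [b b0 hx]; exists (a * b); first exact: mulr_ge0.
by rewrite -scalerA -scalerBr; apply: IH.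
Qed.

Lemma conic_mem s v : v \in s -> conic s v.
Proof.
elim: s => //= u s IH; rewrite inE => /orP[/eqP ->|vs].
  by exists 1; rewrite // scale1r subrr; apply: conic0.
by exists 0; rewrite // scale0r subr0; apply: IH.
Qed.

Lemma conic_min s (D : V -> Prop) : D 0 ->
    (forall x y, D x -> D y -> D (x + y)) ->
    (forall a v, v \in s -> 0 <= a -> D (a *: v)) ->
  forall x, conic s x -> D x.
Proof.
move=> D0 DD; elim: s => [|v s IH] DZ x /=; first by move->.
case=> a a0 hx; rewrite -(subrK (a *: v) x); apply: DD.
  by apply: IH hx => b u us; apply: DZ; rewrite inE us orbT.
by apply: DZ; rewrite // mem_head.
Qed.

Lemma conic_sub s t : (forall v, v \in s -> conic t v) ->
  forall x, conic s x -> conic t x.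
Proof.
move=> st; apply: conic_min; [exact: conic0|exact: conicD|].
by move=> a v vs a0; apply/conicZ => //; apply: st.
Qed.

(** Lifts a conic relation back from a projection along [v]; the price is a real multiple of [v] of
    unknown sign. *)
Lemma conic_map_shift s v (k : V -> R) y : conic (map (fun u => u - k u *: v) s) y ->
  exists2 z, conic s z & exists r, y = z + r *: v.
Proof.
elim: s y => [|u s IH] y /=.
  by move=> ->; exists 0 => //; exists 0; rewrite scale0r addr0.
case=> b b0 /IH[z hz [r yr]].
exists (z + b *: u); first by exists b => //; rewrite addrK.
exists (r - b * k u); apply/rowP => i.
by have := congr1 (fun x : V => x 0 i) yr; rewrite !mxE; lra.
Qed.

(** Induction on the number of generators, after projecting all others orthogonally to the first
    one, [a]. A functional positive on the projections can be made orthogonal to [a] and then tilted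
    slightly towards [a]; a relation between the projections lifts to z + v = q a, and the sign of q
    decides. *)
Lemma gordan s : (exists w, forall v, v \in s -> 0 < pairing w v) \/
                 (exists2 v, v \in s & conic s (- v)).
Proof.
have [n] := ubnP (size s); elim: n s => // n IHn [|a s] sz; first by left; exists 0.
rewrite /= ltnS in sz.
have [a0|a0] := eqVneq a 0.
  right; exists a; first exact: mem_head.
  have -> : - a = 0 by rewrite a0 oppr0.
  exact: conic0.
have aa := pairing_self_gt0 a0.
pose pr v := v - (pairing a v / pairing a a) *: a.
have [] := IHn (map pr s); first by rewrite size_map.
  case=> [w hw]; left.
  (* The projection is self-adjoint, so [w'] takes on v the value of [w] on [pr v], and it kills
     [a]. *)
  pose w' := pr w.
  have w'a : pairing w' a = 0.
    by rewrite pairingBl pairingZl divfK ?gt_eqF // pairingC subrr.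
  have w'v v : v \in s -> 0 < pairing w' v.
    move=> vs; have := hw (pr v) (map_f _ vs).
    rewrite pairingBl pairingBr pairingZl pairingZr (pairingC w a).
    by rewrite mulrAC (mulrAC (pairing a w)) (mulrC (pairing a v)).
  have [e e0 he] : exists2 e, 0 < e & forall v, v \in s ->
      0 < pairing w' v + e * pairing a v.
    elim: (s) w'v => [|u t IHt] h; first by exists 1.
    have [e e0 he] := IHt (fun v vt => h v (mem_behead (s := u :: t) vt)).
    have hu := h u (mem_head _ _).
    have [pu|pu] := leP 0 (pairing a u).
      exists e => // v; rewrite inE => /orP[/eqP->|/he//].
      by apply: (lt_le_trans hu); rewrite lerDl mulr_ge0 // ltW.
    (* Half the critical ratio keeps the value at [u] strictly positive. Shrinking [e] does no harm
       to the other generators, whatever the sign of their pairing with [a]. *)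
    pose e' := Num.min e (pairing w' u / (- pairing a u) / 2).
    have e'0 : 0 < e'.
      by rewrite lt_min e0 /= !divr_gt0 // oppr_gt0.
    exists e' => // v; rewrite inE => /orP[/eqP->|vt].
      have : e' <= pairing w' u / (- pairing a u) / 2 by rewrite ge_min lexx orbT.
      rewrite ler_pdivlMr // ler_pdivlMr ?oppr_gt0 //; lra.
    have {}he := he _ vt; have ht := h v (mem_behead (s := u :: t) vt).
    have e'e : e' <= e by rewrite ge_min lexx.
    have [pv|pv] := leP 0 (pairing a v).
      by apply: (lt_le_trans ht); rewrite lerDl mulr_ge0 // ltW.
    apply: (lt_le_trans he); rewrite lerD2l.
    by rewrite ler_wnM2r // ltW.
  exists (w' + e *: a) => v; rewrite inE => /orP[/eqP->|vs].
    by rewrite pairingDl w'a add0r pairingZl mulr_gt0.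
  by rewrite pairingDl pairingZl he.
case=> _ /mapP[v vs ->] /(conic_map_shift (k := fun u => pairing a u / pairing a a))[z hz [r hr]].
have {hr} [q hq] : exists q, z + v = q *: a.
  exists (pairing a v / pairing a a - r); apply/rowP => i.
  by have := congr1 (fun x : V => x 0 i) hr; rewrite /pr !mxE; lra.
have hcs : conic s (q *: a) by rewrite -hq; apply: conicD => //; apply: conic_mem.
(* If q <= 0, then -v = z + (-q) a is conic. If q > 0, then [a] itself lies in the cone of [s], and
   the alternative for [s] alone settles the matter. *)
have [q0|q0] := leP q 0.
  right; exists v; first by rewrite inE vs orbT.
  exists (- q); first by rewrite oppr_ge0.
  by rewrite scaleNr opprK -hq addrCA addNr addr0.
have hca : conic s a.
  have := @conicZ s q^-1 (q *: a); rewrite scalerA mulVf ?gt_eqF // scale1r.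
  by apply => //; rewrite invr_ge0 ltW.
have [[w hw]|[u us hu]] := IHn s sz.
- left; exists w => u; rewrite inE => /orP[/eqP->|/hw//].
  suff: 0 < pairing w (q *: a) by rewrite pairingZr pmulr_rgt0.
  rewrite -hq pairingDr ltr_wpDl ?hw //.
  apply: (conic_min (D := fun x => 0 <= pairing w x)) hz => [|x y|b u' us b0].
  + by rewrite pairing0r.
  + by rewrite pairingDr; apply: addr_ge0.
  + by rewrite pairingZr mulr_ge0 // ltW // hw.
- right; exists u; first by rewrite inE us orbT.
  by exists 0; rewrite // scale0r subr0.
Qed.

End ConicHulls.

(** * Rays and faces of strongly convex rational cones *)

Section ConesAndRays.
Variables (R : realType) (d : nat).
Local Notation V := 'rV[R]_d.
Implicit Types (c e rho : set V) (x y w : V).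

Lemma rational_coneP c : rational_cone c -> exists s : seq V, forall x, c x <-> conic s x.
Proof.
case=> n [s ->]; elim: n s => [|n IH] s.
  exists [::] => x; split=> /= [[a _ ->]|->]; first by rewrite big_ord0.
  by exists (fun=> 0) => //; rewrite big_ord0.
have [t ht] := IH (s \o lift ord0).
exists (latv R (s ord0) :: t) => x; split=> /=.
  case=> a a0 ->; exists (a ord0) => //; apply/ht; exists (a \o lift ord0) => [i|] //.
    exact: a0.
  by rewrite big_ord_recl addrAC subrr add0r.
case=> b b0 /ht[a a0 hx].
exists (fun i => if unlift ord0 i is Some j then a j else b).
  by move=> i; case: unliftP => [j _|_] //; apply: a0.
rewrite big_ord_recl unlift_none -[LHS](subrK (b *: latv R (s ord0))) hx addrC.
by congr (_ + _); apply: eq_bigr => i _; rewrite liftK.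
Qed.

Lemma conic_pos_eq0 (s : seq V) w y : (forall v, v \in s -> 0 < pairing w v) ->
  conic s y -> 0 <= pairing w y /\ (pairing w y = 0 -> y = 0).
Proof.
elim: s y => [|u s IH] y hs /=; first by move=> ->; rewrite pairing0r.
case=> a a0 /IH[v vs|h0 h1]; first by apply: hs; rewrite inE vs orbT.
have hu := hs u (mem_head _ _).
have au0 : 0 <= a * pairing w u by rewrite mulr_ge0 // ltW.
move: h0 h1; rewrite pairingBr pairingZr => h0 h1.
split=> [|y0]; first by lra.
have au : a * pairing w u = 0 by lra.
have a_eq0 : a = 0 by apply/eqP; move/eqP: au; rewrite mulf_eq0 (gt_eqF hu) orbF.
by move: h1; rewrite a_eq0 scale0r subr0; apply; lra.
Qed.

(* Each generator of an irredundant generating family spans an exposed ray:   *)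
(* Gordan's alternative applied to the other generators, projected along it,  *)
(* provides the exposing functional.                                          *)
Lemma conic_rays_ind (s : seq V) c (D : V -> Prop) :
    (forall x, c x <-> conic s x) -> strongly_convex c -> D 0 ->
    (forall x y, D x -> D y -> D (x + y)) ->
    (forall rho x, rays c rho -> rho x -> D x) ->
  forall x, c x -> D x.
Proof.
have [n] := ubnP (size s); elim: n s => // n IHn s sz hc sc D0 DD Dray.
(* Redundant generators are discarded until none is left. *)
have [[v vs hv]|irr] := pselect (exists2 v, v \in s & conic (rem v s) v).
  apply: (IHn (rem v s)) => //.
    by rewrite size_rem //; case: (s) vs sz.
  move=> x; rewrite hc; split; apply: conic_sub => u us.
    have := perm_mem (perm_to_rem vs) u; rewrite us inE => /esym/orP[/eqP->//|].
    exact: conic_mem.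
  by apply: conic_mem; apply: mem_rem us.
suff ray v : v \in s -> rays c [set x | exists2 a, 0 <= a & x = a *: v].
  move=> x /hc; move: x; apply: conic_min => // a v vs a0.
  by apply: Dray (ray v vs) _; exists a.
move=> vs.
have sv u : u \in rem v s -> u \in s by exact: mem_rem.
have v0 : v != 0.
  by apply/eqP => v0; apply: irr; exists v => //; rewrite {2}v0; apply: conic0.
split; first by exists v.
have vv := pairing_self_gt0 v0.
pose pr u := u - (pairing v u / pairing v v) *: v.
have sub_c u : conic (rem v s) u -> c u.
  by move=> hu; apply/hc; apply: conic_sub hu => u' /sv; apply: conic_mem.
have cv : c v by apply/hc; apply: conic_mem.
have [[w hw]|[_ /mapP[u us ->]]] := gordan (map pr (rem v s)); last first.
  (* Gordan's second alternative would give z + u = q v. If q > 0, then v is redundant; if q <= 0,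
     then -u lies in [c], so u = 0 by strong convexity, and 0 is always redundant. *)
  move=> /(conic_map_shift (k := fun u => pairing v u / pairing v v))[z hz [r hr]].
  have {hr} [q hq] : exists q, z + u = q *: v.
    exists (pairing v u / pairing v v - r); apply/rowP => i.
    by have := congr1 (fun x : V => x 0 i) hr; rewrite /pr !mxE; lra.
  have hcs : conic (rem v s) (q *: v).
    by rewrite -hq; apply: conicD => //; apply: conic_mem.
  have [q0|q0] := leP q 0; last first.
    case: irr; exists v => //.
    have := @conicZ _ _ (rem v s) q^-1 (q *: v).
    rewrite scalerA mulVf ?gt_eqF // scale1r.
    by apply => //; rewrite invr_ge0 ltW.
  case: irr; exists u; first exact: sv.
  suff -> : u = 0 by apply: conic0.
  apply: sc; first by apply: sub_c; apply: conic_mem.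
  have -> : - u = z + (- q) *: v.
    by rewrite scaleNr -hq opprD addrA subrr add0r.
  apply/hc; apply: conicD; first by apply/hc; apply: sub_c.
  by apply: conicZ; rewrite ?oppr_ge0 //; apply/hc.
pose w' := w - (pairing w v / pairing v v) *: v.
have w'v : pairing w' v = 0.
  by rewrite pairingBl pairingZl divfK ?gt_eqF // subrr.
have w'u u : u \in rem v s -> 0 < pairing w' u.
  move=> us; have := hw (pr u) (map_f _ us).
  rewrite pairingBl pairingBr pairingZl pairingZr.
  by rewrite mulrAC (mulrAC (pairing w v)) (mulrC (pairing v u)).
have dec x : c x -> exists a y, [/\ 0 <= a, conic (rem v s) y & x = y + a *: v].
  move=> /hc; move: x; apply: conic_min.
  - by exists 0, 0; split; rewrite ?scale0r ?addr0 //; apply: conic0.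
  - move=> _ _ [a [y [a0 hy ->]]] [b [z [b0 hz ->]]]; exists (a + b), (y + z).
    by split; [apply: addr_ge0|apply: conicD|rewrite scalerDl addrACA].
  - move=> a u us a0.
    have := perm_mem (perm_to_rem vs) u; rewrite us inE => /esym/orP[/eqP->|us'].
      by exists a, 0; split; rewrite ?add0r //; apply: conic0.
    exists 0, (a *: u); split; rewrite ?scale0r ?addr0 //.
    by apply: conicZ => //; apply: conic_mem.
exists w'; split=> [x /dec[a [y [a0 hy ->]]]|].
  by rewrite pairingDr pairingZr w'v mulr0 addr0; have [] := conic_pos_eq0 w'u hy.
apply/seteqP; split=> x /=.
  case=> a a0 ->; split; first by apply/hc; apply: conicZ => //; apply/hc.
  by rewrite pairingZr w'v mulr0.
case=> /dec[a [y [a0 hy ->]]].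
rewrite pairingDr pairingZr w'v mulr0 addr0 => y0; exists a => //.
by have [_ ->] := conic_pos_eq0 w'u hy; rewrite ?add0r.
Qed.

Lemma cone_rays_ind c (D : V -> Prop) :
    rational_cone c -> strongly_convex c -> D 0 ->
    (forall x y, D x -> D y -> D (x + y)) ->
    (forall rho x, rays c rho -> rho x -> D x) ->
  forall x, c x -> D x.
Proof. by move=> /rational_coneP[s hs]; apply: conic_rays_ind hs. Qed.

Lemma face_sub e c : face e c -> e `<=` c.
Proof. by case=> w [_ ->] x []. Qed.

Lemma face_restrict e c c1 : face e c -> c1 `<=` c -> face (c1 `&` e) c1.
Proof.
case=> w [w0 ->] c1c; exists w; split=> [x /c1c/w0//|].
by apply/seteqP; split=> x /= [c1x]; [case|split=> //; split=> //; apply: c1c].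
Qed.

(** A functional that is nonnegative on the cone and vanishes on a sum vanishes on both terms. *)
Lemma face_addP e c x y : face e c -> c x -> c y -> e (x + y) -> e x /\ e y.
Proof.
case=> w [w0 ->] cx cy [_]; rewrite pairingDr.
by move: (w0 x cx) (w0 y cy) => *; split; split=> //; lra.
Qed.

Lemma conv_hull_mem (A : set V) x : A x -> conv_hull A x.
Proof.
by move=> Ax; exists 1%N, (fun=> x), (fun=> 1); split; rewrite ?big_ord1 ?scale1r.
Qed.

Lemma conv_hull_le (A : set V) w r x :
  (forall y, A y -> pairing w y <= r) -> conv_hull A x -> pairing w x <= r.
Proof.
move=> wA [n [p [a [pA a0 a1 ->]]]]; rewrite pairing_sumr.
apply: (@le_trans _ _ (\sum_i a i * r)); last by rewrite -mulr_suml a1 mul1r.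
by apply: ler_sum => i _; rewrite pairingZr ler_wpM2l // wA.
Qed.

End ConesAndRays.

(** * Fans and height functions *)

Section FanCones.
Variables (R : realType) (d : nat) (S : stacky_fan R d).
Local Notation V := 'rV[R]_d.
Implicit Types (c e rho : set V) (x y w : V).

Lemma cone0 c : c \in cones S -> c 0.
Proof.
have [rat _ _] := conesP S; move=> /rat[[n [s ->]] _].
by exists (fun=> 0) => //; rewrite big1 // => i _; rewrite scale0r.
Qed.

Lemma coneD c x y : c \in cones S -> c x -> c y -> c (x + y).
Proof.
have [rat _ _] := conesP S; move=> /rat[/rational_coneP[s hs] _].
by rewrite !hs; apply: conicD.
Qed.

Lemma coneZ c a x : c \in cones S -> 0 <= a -> c x -> c (a *: x).
Proof.
have [rat _ _] := conesP S; move=> /rat[/rational_coneP[s hs] _].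
by rewrite !hs; apply: conicZ.
Qed.

Lemma face_cones c e : c \in cones S -> face e c -> e \in cones S.
Proof. by have [_ fc _] := conesP S; apply: fc. Qed.

Lemma cones_face_setI c e : c \in cones S -> e \in cones S -> face (c `&` e) c.
Proof. by have [_ _ fI] := conesP S => cS eS; have [] := fI _ _ cS eS. Qed.

Lemma cones_setI c e : c \in cones S -> e \in cones S -> c `&` e \in cones S.
Proof. by move=> cS eS; apply: (face_cones cS); apply: cones_face_setI. Qed.

Lemma cones_sub_face c e : c \in cones S -> e \in cones S -> e `<=` c -> face e c.
Proof.
by move=> cS eS ec; have := cones_face_setI cS eS; rewrite setIidr.
Qed.

Lemma cones_face_trans c e c1 :
  c \in cones S -> face e c -> face c1 e -> face c1 c.
Proof.
move=> cS ec c1e; have eS := face_cones cS ec.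
apply: cones_sub_face => //; first exact: face_cones c1e.
by apply: subset_trans (face_sub c1e) (face_sub ec).
Qed.

Lemma cones_ray_mult rho y : rho \in cones S -> is_ray rho -> rho y ->
  exists2 t, 0 <= t & y = t *: latv R (svec S rho).
Proof.
move=> rS rr; have [sv0 rsv] := svecP rS rr.
have [v v0 rhoE] := rr.
have rhoP z : rho z -> exists2 a, 0 <= a & z = a *: v by rewrite rhoE.
have [a a0 av] := rhoP _ rsv; move=> /rhoP[b b0 ->].
have a_neq0 : a != 0.
  apply: contra sv0 => /eqP az; move: av; rewrite az scale0r => h.
  apply/eqP; apply/rowP => i; have := congr1 (fun u : V => u 0 i) h.
  by rewrite !mxE => /eqP; rewrite intr_eq0 => /eqP.
exists (b / a); first by rewrite divr_ge0.
by rewrite av scalerA divfK.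
Qed.

(** Cones are generated by their rays and rays by their stacky vectors, so linear identities and
    inequalities need checking on stacky vectors only. *)
Lemma cones_ind c (D : V -> Prop) : c \in cones S -> D 0 ->
    (forall x y, D x -> D y -> D (x + y)) ->
    (forall rho t, rays c rho -> rho \in cones S -> 0 <= t ->
       D (t *: latv R (svec S rho))) ->
  forall x, c x -> D x.
Proof.
move=> cS D0 DD Dr; have [rat _ _] := conesP S; have [rc sc] := rat _ cS.
apply: cone_rays_ind rc sc D0 DD _ => rho x rho_c rx.
have rS : rho \in cones S by apply: (face_cones cS); case: rho_c.
by have [||t t0 ->] := cones_ray_mult _ _ rx; [|case: rho_c|apply: Dr].
Qed.

(** The finitely many cones around [A] are intersected one by one, and a fan is closed under
    intersection. *)
Lemma smallest_cone_exists (A : set V) s : s \in cones S -> A `<=` s ->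
  exists t, smallest_cone S A t.
Proof.
move=> sS As.
suff H (L : seq (set V)) : (forall c, c \in L -> c \in cones S /\ A `<=` c) ->
    exists t, [/\ t \in cones S, A `<=` t & forall c, c \in L -> t `<=` c].
  have [c|t [tS At tmin]] := H [seq c <- enum_fset (cones S) | `[< A `<=` c >]].
    by rewrite mem_filter => /andP[/asboolP].
  exists t; split=> // c cS Ac; apply: tmin.
  by rewrite mem_filter cS andbT; apply/asboolP.
elim: L => [|c L IH] HL; first by exists s.
have [c' c'L|t [tS At tmin]] := IH; first by apply: HL; rewrite inE c'L orbT.
have [cS Ac] := HL c (mem_head _ _).
exists (t `&` c); split; first exact: cones_setI.
  by rewrite subsetI.
move=> c'; rewrite inE => /orP[/eqP->|/tmin tc']; first exact: subIsetr.
by apply: subset_trans tc'; apply: subIsetl.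
Qed.

End FanCones.

Section Heights.
Variables (R : realType) (d : nat) (S : stacky_fan R d).
Local Notation V := 'rV[R]_d.
Implicit Types (c e rho : set V) (x y w : V).

(** Both forms equal 1 on the stacky vectors of the common face of [c] and [c1], which generate that
    face. This makes the height single-valued. *)
Lemma height_form_unique c c1 q q1 x : c \in cones S -> c1 \in cones S ->
    is_height_form S c q -> is_height_form S c1 q1 -> c x -> c1 x ->
  pairing (ratv R q) x = pairing (ratv R q1) x.
Proof.
move=> cS c1S hq hq1 cx c1x.
have fc := cones_face_setI cS c1S.
have fc1 : face (c `&` c1) c1 by rewrite setIC; apply: (cones_face_setI c1S cS).
have eS := cones_setI cS c1S.
apply: (cones_ind (S := S) (c := c `&` c1)
  (D := fun x => pairing (ratv R q) x = pairing (ratv R q1) x)) => //.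
- by rewrite !pairing0r.
- by move=> y z hy hz; rewrite !pairingDr hy hz.
- move=> rho t [rr fr] rS t0; rewrite !pairingZr hq ?hq1 //.
    by split=> //; apply: cones_face_trans c1S fc1 fr.
  by split=> //; apply: cones_face_trans cS fc fr.
Qed.

Lemma heightE c q x : c \in cones S -> is_height_form S c q -> c x ->
  height S x = pairing (ratv R q) x.
Proof.
move=> cS hq cx; rewrite /height.
case: xgetP => [r _ [c1 [q1 [c1S c1x hq1 ->]]]|]; last first.
  by move/(_ (pairing (ratv R q) x)) => []; exists c, q.
exact: (height_form_unique c1S cS).
Qed.

Hypothesis lqg : log_Q_Gorenstein S.

Lemma heightD c x y : c \in cones S -> c x -> c y ->
  height S (x + y) = height S x + height S y.
Proof.
move=> cS cx cy; have [q hq] := lqg cS.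
by rewrite !(heightE cS hq) ?pairingDr //; apply: coneD cS cx cy.
Qed.

Lemma height_ge0 c x : c \in cones S -> c x -> 0 <= height S x.
Proof.
move=> cS cx; have [q hq] := lqg cS; rewrite (heightE cS hq) //.
apply: (cones_ind (S := S) (c := c) (D := fun x => 0 <= pairing (ratv R q) x)) => //.
- by rewrite pairing0r.
- by move=> y z; rewrite pairingDr; apply: addr_ge0.
- by move=> rho t rr _ t0; rewrite pairingZr hq // mulr1.
Qed.

(* If w <= r cuts out a face of the polytope, then w <= r psi on the support, *)
(* so psi >= 1 on that face when r > 0.                                       *)
Lemma height_one g c v : height_one_rep g (Ppoly S) -> v \in msupp g ->
  c \in cones S -> c (latv R v) -> height S (latv R v) = 1.
Proof.
case=> _ hg vg cS cv.
have [F [w [r [Pw ->]]] [/= nF0 [Pv wv]]] := hg v vg.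
have P_ray c' rho : c' \in cones S -> rays c' rho ->
    pairing w (latv R (svec S rho)) <= r.
  move=> c'S rr; apply: Pw; exists c' => //.
  by apply: conv_hull_mem; right; exists rho.
(* The polytope contains 0, so r >= 0; the face misses 0, so r is not 0. *)
have r0 : 0 < r.
  rewrite lt0r; apply/andP; split.
    apply/eqP => rz; apply: nF0; split; last by rewrite pairing0r rz.
    by exists c => //; apply: conv_hull_mem; left.
  have := Pw 0; rewrite pairing0r; apply.
  by exists c => //; apply: conv_hull_mem; left.
(* The upper bound holds because [v] lies in some [Delta], whose generating points have height 0 or
   1. *)
have le1 : height S (latv R v) <= 1.
  case: Pv => c' c'S D; have [q hq] := lqg c'S.
  suff [c'v qv] : c' (latv R v) /\ pairing (ratv R q) (latv R v) <= 1.
    by rewrite (heightE c'S hq).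
  split; last first.
    apply: conv_hull_le D => y [->|[rho rr <-]]; first by rewrite pairing0r.
    by rewrite hq.
  case: D => n [p [a [pA a0 _ ->]]].
  elim: n p a pA a0 => [|n IH] p a pA a0; first by rewrite big_ord0; apply: cone0 c'S.
  rewrite big_ord_recl; apply: (coneD c'S); last by apply: IH => i; [apply: pA|apply: a0].
  apply: (coneZ c'S) => //; case: (pA ord0) => [->|[rho [rr fr] <-]]; first exact: cone0 c'S.
  by have [] := svecP (face_cones c'S fr) rr => _; apply: face_sub fr _.
have [q hq] := lqg cS.
apply/eqP; rewrite eq_le le1 /=.
suff : pairing w (latv R v) <= r * pairing (ratv R q) (latv R v).
  by rewrite wv (heightE cS hq) // -{1}[r]mulr1 ler_pM2l.
apply: (cones_ind (S := S) (c := c)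
  (D := fun x => pairing w x <= r * pairing (ratv R q) x)) => //.
- by rewrite !pairing0r mulr0.
- by move=> y z hy hz; rewrite !pairingDr mulrDr lerD.
- move=> rho t rr _ t0; rewrite !pairingZr hq // mulr1 mulrC.
  by rewrite ler_wpM2r // (P_ray c).
Qed.

End Heights.

(** A height form of [S] on a cone [s] around [c] is also a height form of [G] on [c]: retained rays
    keep their stacky vectors, and crepancy gives the new ones height 1. *)
Lemma height_crepant (R : realType) (d : nat) (S G : stacky_fan R d) c x :
  log_Q_Gorenstein S -> subdivision G S -> crepant G S ->
  c \in cones G -> c x -> height G x = height S x.
Proof.
move=> lqg [_ ref old] cr cG cx; have [s sS cs] := ref c cG; have [q hq] := lqg s sS.
rewrite (heightE sS hq (cs _ cx)); apply: (heightE cG) => // rho rr.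
have rG : rho \in cones G by apply: (face_cones cG); case: rr.
have [rr' fr] := rr; have rs := subset_trans (face_sub fr) cs.
have [rS|rS] := boolP (rho \in cones S).
  have [_ ->] := old _ rS rr'; apply: hq; split=> //.
  exact: (cones_sub_face sS).
rewrite -(heightE sS hq) ?cr //; apply: rs.
by have [] := svecP rG rr'.
Qed.

(** * Positivity of the pairing and orthogonal pairs of cones *)

Section MirrorPositivity.
Variables (R : realType) (d : nat) (S S' : stacky_fan R d).
Implicit Types (c : set 'rV[R]_d) (x y : 'rV[R]_d).

(** Stacky vectors of [S'] lie in the Newton polytope of [f], and regularity of [f] says that its
    exponents are nonnegative on the cones of [S]. *)
Lemma mirror_pairing_ge0 f c c' x y : regular_on S f -> Ppoly S' = newton0 f ->
  c \in cones S -> c' \in cones S' -> c x -> c' y -> 0 <= pairing x y.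
Proof.
move=> reg PS' cS c'S cx; move: y.
apply: (cones_ind c'S) => [|y z|rho t rr _ t0].
- by rewrite pairing0r.
- by rewrite pairingDr; apply: addr_ge0.
- rewrite pairingZr mulr_ge0 //.
  have : Ppoly S' (latv R (svec S' rho)).
    by exists c' => //; apply: conv_hull_mem; right; exists rho.
  rewrite PS' => N; rewrite -oppr_le0 -pairingNr pairingC -scaleN1r pairingZl -pairingZr.
  rewrite pairingC; apply: conv_hull_le N => _ [->|[v vf <-]].
    by rewrite pairing0r.
  by rewrite pairingC pairingZr mulN1r oppr_le0 pairingC (reg c).
Qed.

(** By positivity, the vectors of [s] orthogonal to a given y in [c'] form a face of [s]. It
    contains [c], so by minimality it is all of [s]; the same argument on the other side then
    replaces [c'] by [s']. *)
Lemma orthogonal_smallest c c' s s' :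
    (forall c c' x y, c \in cones S -> c' \in cones S' -> c x -> c' y ->
       0 <= pairing x y) ->
    orthogonal c c' -> smallest_cone S c s -> smallest_cone S' c' s' ->
  orthogonal s s'.
Proof.
move=> pos cc' [sS cs smin] [s'S c's' s'min].
have sc' x y : s x -> c' y -> pairing x y = 0.
  move=> sx c'y.
  have fc : face [set x | s x /\ pairing y x = 0] s.
    exists y; split=> // z sz; rewrite pairingC.
    by apply: (pos s s') => //; apply: c's'.
  have /(_ _ sx)[_] : s `<=` [set x | s x /\ pairing y x = 0].
    apply: smin; first exact: face_cones fc.
    by move=> z cz; split; [apply: cs|rewrite pairingC cc'].
  by rewrite pairingC.
move=> x y sx s'y.
have fc : face [set y | s' y /\ pairing x y = 0] s'.
  by exists x; split=> // z s'z; apply: (pos s s').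
have /(_ _ s'y)[_ //] : s' `<=` [set y | s' y /\ pairing x y = 0].
apply: s'min; first exact: face_cones fc.
by move=> z c'z; split; [apply: c's'|apply: sc'].
Qed.

End MirrorPositivity.

(** * The exterior algebra *)

Section ExteriorAlgebra.
Variables (R : realType) (d : nat).
Local Notation ext := (ext R d).
Local Notation sign := (@ext_sign R d).
Implicit Types (u v : 'rV[int]_d) (w : ext) (i j : 'I_d) (J : {set 'I_d}).

Lemma ext_signU i j J : j \notin J -> sign i (j |: J) = (-1) ^+ (j < i)%N * sign i J.
Proof.
move=> jJ; rewrite /ext_sign -exprD; congr (_ ^+ _).
rewrite (cardD1 j) inE !inE eqxx /=; congr (_ + _)%N.
apply: eq_card => k; rewrite !inE; case: eqVneq => //= ->.
by rewrite (negPf jJ).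
Qed.

Lemma ext_signD1 i j J : j \in J -> sign i J = (-1) ^+ (j < i)%N * sign i (J :\ j).
Proof. by move=> jJ; rewrite -{1}(finset.setD1K jJ) ext_signU // !inE eqxx. Qed.

Lemma ext_sign_sqr i J : sign i J * sign i J = 1.
Proof. by rewrite /ext_sign -exprD addnn -mul2n exprM sqrrN expr1n expr1n. Qed.

Lemma sign_ltn_swap i j : i != j ->
  (-1) ^+ (i < j)%N = - (-1) ^+ (j < i)%N :> R[i].
Proof. by move=> ij; case: ltngtP => [||/val_inj/eqP]; rewrite ?opprK ?(negPf ij). Qed.

Lemma wedgeDl u v w : wedge (u + v) w = wedge u w + wedge v w.
Proof.
apply/ffunP => J; rewrite !ffunE -big_split; apply: eq_bigr => i _ /=.
by rewrite mxE intrD mulrDr mulrDl.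
Qed.

Lemma wedge_basisE u w J : wedge u w J = \sum_I w I * wedge u (ext_basis R I) J.
Proof.
rewrite ffunE; under [RHS]eq_bigr do rewrite ffunE mulr_sumr.
rewrite exchange_big; apply: eq_bigr => i _ /=.
rewrite (bigD1 (J :\ i)) //= ffunE eqxx mulr1 big1 ?addr0; first by rewrite mulrC.
by move=> I IJ; rewrite ffunE eq_sym (negPf IJ) !mulr0.
Qed.

Lemma contract_basisE u w J :
  contract u w J = \sum_I w I * contract u (ext_basis R I) J.
Proof.
rewrite ffunE; under [RHS]eq_bigr do rewrite ffunE mulr_sumr.
rewrite exchange_big; apply: eq_bigr => i _ /=.
rewrite (bigD1 (i |: J)) //= ffunE eqxx mulr1 big1 ?addr0; first by rewrite mulrC.
by move=> I IJ; rewrite ffunE eq_sym (negPf IJ) !mulr0.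
Qed.

(** Both sides are sums over ordered pairs of distinct indices; exchanging the two indices flips the
    sign, by [sign_ltn_swap]. *)
Lemma wedge_anticomm u v w : wedge u (wedge v w) = - wedge v (wedge u w).
Proof.
apply/ffunP => J; rewrite !ffunE.
pose F u v i j := if [&& i \in J, j \in J & i != j] then
  sign i J * (u 0 i)%:~R * (sign j (J :\ i) * (v 0 j)%:~R * w (J :\ i :\ j)) else 0.
have E u' v' : \sum_(i | i \in J) sign i J * (u' 0 i)%:~R * wedge v' w (J :\ i) =
    \sum_i \sum_j F u' v' i j.
  rewrite big_mkcond; apply: eq_bigr => i _; rewrite /F; case: ifP => iJ /=; last by rewrite big1.
  rewrite ffunE mulr_sumr big_mkcond; apply: eq_bigr => j _; rewrite !inE eq_sym andbC.
  by case: ifP => //.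
rewrite !E exchange_big -sumrN; apply: eq_bigr => i _; rewrite -sumrN; apply: eq_bigr => j _.
rewrite /F (eq_sym j) andbCA; case: ifP => [/and3P[iJ jJ ij]|]; last by rewrite oppr0.
rewrite (ext_signD1 j iJ) (ext_signD1 i jJ) (sign_ltn_swap ij).
have -> : J :\ j :\ i = J :\ i :\ j by apply/setP => k; rewrite !inE andbCA.
by ring.
Qed.

Lemma contract_anticomm u v w : contract u (contract v w) = - contract v (contract u w).
Proof.
apply/ffunP => J; rewrite !ffunE.
pose F u v i j := if [&& i \notin J, j \notin J & i != j] then
  sign i J * (u 0 i)%:~R * (sign j (i |: J) * (v 0 j)%:~R * w (j |: (i |: J))) else 0.
have E u' v' : \sum_(i | i \notin J) sign i J * (u' 0 i)%:~R * contract v' w (i |: J) =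
    \sum_i \sum_j F u' v' i j.
  rewrite big_mkcond; apply: eq_bigr => i _; rewrite /F; case: ifP => iJ /=; last by rewrite big1.
  rewrite ffunE mulr_sumr big_mkcond; apply: eq_bigr => j _.
  by rewrite !inE negb_or eq_sym andbC.
rewrite !E exchange_big -sumrN; apply: eq_bigr => i _; rewrite -sumrN; apply: eq_bigr => j _.
rewrite /F (eq_sym j) andbCA; case: ifP => [/and3P[iJ jJ ij]|]; last by rewrite oppr0.
rewrite (ext_signU i jJ) (ext_signU j iJ) (sign_ltn_swap ij) (finset.setUCA [set i]).
by ring.
Qed.

(** The Clifford relation. Diagonal terms with i outside J come from the first summand and those
    with i in J from the second; together they give the pairing of u and v. The off-diagonal terms
    [F] cancel. *)
Lemma contract_wedge u v w J :
  contract u (wedge v w) J + wedge v (contract u w) J =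
  (\sum_i u 0 i * v 0 i)%:~R * w J.
Proof.
rewrite ffunE [wedge v (contract u w) J]ffunE.
pose F i j := if (i \notin J) && (j \in J) then
  sign i J * (u 0 i)%:~R * (sign j (i |: J) * (v 0 j)%:~R * w (i |: (J :\ j))) else 0.
have E1 : \sum_(i : 'I_d | i \notin J) sign i J * (u 0 i)%:~R * wedge v w (i |: J) =
    \sum_(i | i \notin J) (u 0 i * v 0 i)%:~R * w J + \sum_i \sum_j F i j.
  rewrite [X in _ + X](_ : _ = \sum_(i | i \notin J) \sum_j F i j); last first.
    rewrite [RHS]big_mkcond; apply: eq_bigr => i _; case: ifP => // iJ.
    by rewrite big1 // => j _; rewrite /F iJ.
  rewrite -big_split; apply: eq_bigr => i iJ /=.
  rewrite ffunE (bigD1 i) /=; last by rewrite finset.setU11.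
  rewrite mulrDr finset.setU1K //; congr (_ + _).
    rewrite ext_signU // ltnn expr0 mul1r intrM.
    transitivity ((sign i J * sign i J) * ((u 0 i)%:~R * (v 0 i)%:~R * w J)); first by ring.
    by rewrite ext_sign_sqr mul1r.
  rewrite mulr_sumr big_mkcond; apply: eq_bigr => j _; rewrite /F iJ !inE.
  case: eqVneq => [->|ji] /=; first by rewrite (negPf iJ).
  rewrite andbT; case: ifP => // jJ.
  suff -> : (i |: J) :\ j = i |: J :\ j by [].
  by apply/setP => k; rewrite !inE; case: eqVneq => // ->; rewrite (negPf ji).
have E2 : \sum_(j | j \in J) sign j J * (v 0 j)%:~R * contract u w (J :\ j) =
    \sum_(i | i \in J) (u 0 i * v 0 i)%:~R * w J - \sum_i \sum_j F i j.
  rewrite exchange_big.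
  rewrite [X in _ - X](_ : _ = \sum_(j | j \in J) \sum_i F i j); last first.
    rewrite [RHS]big_mkcond; apply: eq_bigr => j _; case: ifP => // jJ.
    by rewrite big1 // => i _; rewrite /F jJ andbF.
  rewrite -sumrN -big_split; apply: eq_bigr => j jJ /=.
  rewrite ffunE (bigD1 j) /=; last by rewrite finset.setD11.
  rewrite mulrDr finset.setD1K //; congr (_ + _).
    rewrite (ext_signD1 j jJ) ltnn expr0 mul1r intrM.
    transitivity ((sign j (J :\ j) * sign j (J :\ j)) * ((u 0 j)%:~R * (v 0 j)%:~R * w J)); first by ring.
    by rewrite ext_sign_sqr mul1r.
  rewrite mulr_sumr -sumrN big_mkcond; apply: eq_bigr => i _; rewrite /F jJ !inE.
  case: eqVneq => [->|ij] /=; first by rewrite jJ oppr0.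
  rewrite andbT; case: ifP => iJ; last by rewrite oppr0.
  rewrite (ext_signU j iJ) (ext_signD1 i jJ) (sign_ltn_swap ij).
  by case: (j < i)%N; rewrite ?expr0 ?expr1; ring.
rewrite E1 E2 addrACA subrr addr0 addrC.
rewrite -big_distrl -big_distrl -mulrDl /=; congr (_ * _).
rewrite -(raddf_sum (intr : int -> R[i])) -(raddf_sum (intr : int -> R[i])) -intrD.
by rewrite [in RHS](bigID (mem J)).
Qed.

Lemma wedge_basis_supp v I J : wedge v (ext_basis R I) J != 0 -> #|J| = #|I|.+1.
Proof.
rewrite ffunE => /eqP h.
have [i /andP[iJ /eqP <-]|none] := pickP [pred i | (i \in J) && (J :\ i == I)].
  by rewrite (cardsD1 i) iJ.
case: h; rewrite big1 // => i iJ; rewrite ffunE.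
by have /= := none i; rewrite iJ /= => ->; rewrite mulr0.
Qed.

Lemma contract_basis_supp v I J : contract v (ext_basis R I) J != 0 -> #|I| = #|J|.+1.
Proof.
rewrite ffunE => /eqP h.
have [i /andP[iJ /eqP <-]|none] := pickP [pred i | (i \notin J) && (i |: J == I)].
  by rewrite cardsU1 iJ.
case: h; rewrite big1 // => i iJ; rewrite ffunE.
by have /= := none i; rewrite iJ /= => ->; rewrite mulr0.
Qed.

End ExteriorAlgebra.

(** * Coefficients and the differential *)

Section LinearProp.
Variables (K : pzRingType) (U V : lmodType K) (f : U -> V).
Hypothesis lf : linear f.

Lemma linear_prop0 : f 0 = 0.
Proof. by have := lf (-1) 0 0; rewrite scaler0 addr0 scaleN1r addNr. Qed.

Lemma linear_propD x y : f (x + y) = f x + f y.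
Proof. by rewrite -[x]scale1r lf !scale1r. Qed.

Lemma linear_propZ a x : f (a *: x) = a *: f x.
Proof. by rewrite -[a *: x]addr0 lf linear_prop0 addr0. Qed.

Lemma linear_propN x : f (- x) = - f x.
Proof. by rewrite -scaleN1r linear_propZ scaleN1r. Qed.

Lemma linear_prop_sum I (r : seq I) (P : pred I) (F : I -> U) :
  f (\sum_(i <- r | P i) F i) = \sum_(i <- r | P i) f (F i).
Proof. exact: (big_morph f linear_propD linear_prop0). Qed.

End LinearProp.

Section FaceTensors.
Variables (R : realType) (d : nat).
Local Notation V := 'rV[R]_d.
Local Notation idx := ('rV[int]_d * 'rV[int]_d * {set 'I_d})%type.
Local Notation C := R[i].
Implicit Types (c e : set V) (z : idx).

Definition in_cones c c' z : bool := `[< c (latv R z.1.1) /\ c' (latv R z.1.2) >].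

Lemma in_conesP c c' z : reflect (c (latv R z.1.1) /\ c' (latv R z.1.2)) (in_cones c c' z).
Proof. exact: asboolP. Qed.

Lemma in_cones_sub c c' e e' z : e `<=` c -> e' `<=` c' -> in_cones e e' z ->
  in_cones c c' z.
Proof. by move=> ec e'c' /in_conesP[h h']; apply/in_conesP; split; [apply: ec|apply: e'c']. Qed.

(** Coefficients are indexed by all triples, with 0 off the cones, so that elements over different
    cones can be compared at the same index. *)
Definition coef c c' (x : face_tensor c c') z : C :=
  if insub z is Some z' then mcoeff (z' : monomial c c') x else 0.

Section Fixed.
Variables c c' : set V.
Implicit Types x y : face_tensor c c'.

Lemma coef_val x (z : monomial c c') : coef x (val z) = mcoeff z x.
Proof. by rewrite /coef valK. Qed.

Lemma coef_out x z : ~~ in_cones c c' z -> coef x z = 0.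
Proof. by move=> hz; rewrite /coef insubF //; apply: negbTE. Qed.

Lemma coefP x y : (forall z, coef x z = coef y z) -> x = y.
Proof. by move=> h; apply/malgP => z; rewrite -!coef_val. Qed.

Lemma coef_linear z a x y : coef (a *: x + y) z = a * coef x z + coef y z.
Proof.
by rewrite /coef; case: insub => [z'|]; rewrite ?mulr0 ?addr0 // mcoeffD mcoeffZ.
Qed.

Lemma coef0 z : coef (0 : face_tensor c c') z = 0.
Proof. by rewrite /coef; case: insub => [z'|] //; rewrite mcoeff0. Qed.

Lemma coefD z x y : coef (x + y) z = coef x z + coef y z.
Proof. by have := coef_linear z 1 x y; rewrite scale1r mul1r. Qed.

Lemma coefZ z a x : coef (a *: x) z = a * coef x z.
Proof. by have := coef_linear z a x 0; rewrite addr0 coef0 addr0. Qed.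

Lemma coef_sum I (r : seq I) (P : pred I) (F : I -> face_tensor c c') z :
  coef (\sum_(i <- r | P i) F i) z = \sum_(i <- r | P i) coef (F i) z.
Proof. by elim/big_rec2: _ => [|i u v _ <-]; rewrite ?coef0 ?coefD. Qed.

Lemma coef_mono z z0 : coef (mono c c' z) z0 = (in_cones c c' z && (z == z0))%:R.
Proof.
rewrite /mono; case: insubP => [z' hz <-|hz]; last first.
  by rewrite coef0 /in_cones (negbTE hz).
rewrite (_ : in_cones _ _ _ = true); last exact: (valP z').
have [<-|ne] := eqVneq (val z') z0; first by rewrite coef_val mcoeffUU.
rewrite /coef; case: insubP => // z1 _ z1E; rewrite mcoeffU.
by case: eqVneq => // e; rewrite -z1E e eqxx in ne.
Qed.

Lemma mono_out z : ~~ in_cones c c' z -> mono c c' z = 0.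
Proof. by move=> hz; rewrite /mono insubF //; apply: negbTE. Qed.

Lemma face_tensor_expand x :
  x = \sum_(z <- msupp (x : {malg C[monomial c c']})) coef x (val z) *: mono c c' (val z).
Proof.
rewrite {1}[x]monalgE; apply: eq_bigr => z _.
rewrite coef_val /mono valK; apply/malgP => k.
by rewrite mcoeffU mcoeffZ mcoeffU mulr_natr.
Qed.

Lemma msupp_coefP x (P : idx -> Prop) :
  (forall z : monomial c c', z \in msupp (x : {malg C[monomial c c']}) -> P (val z)) <->
  (forall z, coef x z != 0 -> P z).
Proof.
split=> h z; last by move=> zx; apply: h; rewrite coef_val mcoeff_neq0.
rewrite /coef; case: insubP => [z' _ <-|]; last by rewrite eqxx.
by rewrite mcoeff_neq0; apply: h.
Qed.

Section LinExt.
Variables (W : lmodType C) (h : idx -> W).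

Lemma lin_extE (D : {fset monomial c c'}) x :
  (forall z : monomial c c', z \in msupp (x : {malg C[monomial c c']}) -> z \in D) ->
  lin_ext h x = \sum_(z <- D) coef x (val z) *: h (val z).
Proof.
move=> xD; rewrite /lin_ext (big_fset_incl _ (A := msupp _) (B := D)) //=.
- by apply: eq_bigr => z _; rewrite coef_val.
- by apply/fsubsetP.
- by move=> z _ zx; rewrite mcoeff_outdom // scale0r.
Qed.

Lemma lin_ext_linear : linear (lin_ext h : face_tensor c c' -> W).
Proof.
move=> a x y.
pose D := (msupp (x : {malg C[monomial c c']}) `|` msupp (y : {malg C[monomial c c']}))%fset.
rewrite !(@lin_extE D); last first.
- move=> z; rewrite -mcoeff_neq0 mcoeffD mcoeffZ; apply: contraR.
  by rewrite inE negb_or => /andP[hx hy]; rewrite !mcoeff_outdom // mulr0 addr0.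
- by move=> z zx; rewrite inE zx.
- by move=> z zx; rewrite inE zx orbT.
rewrite scaler_sumr -big_split; apply: eq_bigr => z _ /=.
by rewrite coef_linear scalerDl scalerA.
Qed.

Lemma lin_ext_mono z : in_cones c c' z -> lin_ext h (mono c c' z) = h z.
Proof.
move=> hz; pose z1 : monomial c c' := Sub z hz.
rewrite (@lin_extE [fset z1]%fset) ?big_seq_fset1.
  by rewrite coef_mono hz eqxx scale1r.
move=> z2; rewrite -mcoeff_neq0 -coef_val coef_mono hz inE.
by apply: contraR => ne; rewrite (negbTE (_ : z != val z2)) //; apply: contra ne => /eqP e; apply/eqP/val_inj.
Qed.

End LinExt.

Lemma mono_span (W : lmodType C) (f g : face_tensor c c' -> W) :
    linear f -> linear g ->
    (forall z, in_cones c c' z -> f (mono c c' z) = g (mono c c' z)) ->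
  forall x, f x = g x.
Proof.
move=> lf lg fg x; rewrite (face_tensor_expand x) !linear_prop_sum //.
by apply: eq_bigr => z _; rewrite !linear_propZ // fg //; apply: (valP z).
Qed.

Lemma lin_ext_supp (P : idx -> Prop) (W : lmodType C) (Q : W -> Prop) (h : idx -> W) x :
    Q 0 -> (forall k v w, Q v -> Q w -> Q (k *: v + w)) ->
    (forall z, in_cones c c' z -> P z -> Q (h z)) ->
    (forall z, coef x z != 0 -> P z) -> Q (lin_ext h x).
Proof.
move=> Q0 QD Qh Px; rewrite /lin_ext big_seq.
have QS v w : Q v -> Q w -> Q (v + w) by move=> Qv Qw; rewrite -[v]scale1r; apply: QD.
apply: big_ind => // z zx; rewrite -[_ *: _]addr0; apply: QD => //; apply: Qh; first exact: (valP z).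
by move/msupp_coefP: Px; apply.
Qed.

End Fixed.

Lemma truncate_linear c c' e e' : linear (@truncate R d c c' e e').
Proof. exact: lin_ext_linear. Qed.

(** One computation for two uses: truncation, with the trivial filter, and [assemble], where the
    filter selects monomials with a prescribed smallest cone. *)
Lemma coef_lin_ext_filter (p : pred idx) c c' e e' (x : face_tensor c c') z :
  coef (lin_ext (fun z => if p z then mono e e' z else 0) x) z =
  if p z && in_cones e e' z then coef x z else 0.
Proof.
rewrite /lin_ext coef_sum.
under eq_bigr => z' _.
  rewrite coefZ (_ : coef _ z = (p z && in_cones e e' z && (val z' == z))%:R); last first.
    have [<-|ne] := eqVneq (val z') z; last first.
      by rewrite andbF; case: ifP => _; rewrite ?coef0 // coef_mono (negbTE ne) andbF.
    by rewrite andbT; case: ifP => _; rewrite ?coef0 // coef_mono eqxx andbT.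
  over.
have [hz|hz] := ifPn; last by rewrite big1 // => z' _; rewrite mulr0.
rewrite [in RHS](face_tensor_expand x) coef_sum; apply: eq_bigr => z' _.
rewrite coefZ coef_mono coef_val.
have hz' : in_cones c c' (val z') by exact: (valP z').
by rewrite hz'.
Qed.

Lemma coef_truncate c c' e e' (x : face_tensor c c') z :
  coef (truncate e e' x) z = if in_cones e e' z then coef x z else 0.
Proof. exact: (coef_lin_ext_filter xpredT). Qed.

Lemma truncate_mono c c' e e' z : e `<=` c -> e' `<=` c' ->
  truncate e e' (mono c c' z) = mono e e' z.
Proof.
move=> ec e'c'; apply: coefP => z0; rewrite coef_truncate !coef_mono.
have [<-|] := eqVneq z z0; last by rewrite !andbF if_same.
rewrite !andbT; have [hz|//] := boolP (in_cones e e' z).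
by rewrite (in_cones_sub ec e'c' hz).
Qed.

Lemma truncate_id c c' (x : face_tensor c c') : truncate c c' x = x.
Proof.
apply: coefP => z; rewrite coef_truncate.
by case: ifPn => // hz; rewrite coef_out.
Qed.

Lemma truncate_truncate c c' e e' b b' (x : face_tensor c c') : b `<=` e -> b' `<=` e' ->
  truncate b b' (truncate e e' x) = truncate b b' x.
Proof.
move=> be b'e'; apply: coefP => z; rewrite !coef_truncate.
by case: ifP => // hz; rewrite (in_cones_sub be b'e' hz).
Qed.

End FaceTensors.

Lemma latvD (R : realType) (d : nat) (u v : 'rV[int]_d) :
  latv R (u + v) = latv R u + latv R v.
Proof. exact: map_mxD. Qed.

Lemma orthogonal_lattice (R : realType) (d : nat) (c c' : set 'rV[R]_d) (u v : 'rV[int]_d) :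
  orthogonal c c' -> c (latv R u) -> c' (latv R v) -> \sum_i u 0 i * v 0 i = 0.
Proof.
move=> cc' cu cv; apply/eqP; rewrite -(intr_eq0 R) raddf_sum /=.
apply/eqP; rewrite -[RHS](cc' _ _ cu cv) pairingE; apply: eq_bigr => i _.
by rewrite intrM !mxE.
Qed.

Lemma eqN_eq0 (K : numFieldType) (W : lmodType K) (x : W) : x = - x -> x = 0.
Proof.
move=> xN; have /eqP : 2%:R *: x = 0 by rewrite scaler_nat mulr2n {1}xN addNr.
by rewrite scaler_eq0 pnatr_eq0 => /eqP.
Qed.

Lemma scale_sum3 (R : realType) (W : lmodType R[i]) (I A B : Type) (r : seq I)
    (rA : seq A) (rB : seq B) (pA : pred A) (pB : pred B)
    (w : I -> R[i]) (a : A -> R[i]) (b : B -> R[i]) (x : A -> I -> W) (y : B -> I -> W) (z : I -> W) :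
  \sum_(i <- r) w i *: (\sum_(j <- rA | pA j) a j *: x j i +
      \sum_(j <- rB | pB j) b j *: y j i + z i) =
  \sum_(j <- rA | pA j) a j *: (\sum_(i <- r) w i *: x j i) +
  \sum_(j <- rB | pB j) b j *: (\sum_(i <- r) w i *: y j i) + \sum_(i <- r) w i *: z i.
Proof.
under eq_bigr do rewrite !scalerDr !scaler_sumr.
rewrite !big_split /=; congr (_ + _ + _).
  rewrite exchange_big; apply: eq_bigr => j _; rewrite scaler_sumr.
  by apply: eq_bigr => i _; rewrite !scalerA mulrC.
rewrite exchange_big; apply: eq_bigr => j _; rewrite scaler_sumr.
by apply: eq_bigr => i _; rewrite !scalerA mulrC.
Qed.

(** * Products in toric face algebras *)

Section Star.
Variables (R : realType) (d : nat) (G : stacky_fan R d).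
Implicit Types (c : set 'rV[R]_d) (u m : 'rV[int]_d).

(** The sum u + m lies in the common face of the two witnessing cones, so by extremality u and m do
    too; the second cone then contains u, v and m at once. *)
Lemma star_assoc c u v m : star_nonzero G c u m -> star_nonzero G c v (u + m) ->
  star_nonzero G c v m /\ star_nonzero G c u (v + m).
Proof.
move=> /asboolP[e eG [ec eu em]] /asboolP[e1 e1G [e1c e1v]]; rewrite latvD => e1um.
have [[_ e1u] [_ e1m]] : (e `&` e1) (latv R u) /\ (e `&` e1) (latv R m).
  apply: (face_addP (cones_face_setI eG e1G)) => //; split=> //.
  exact: (coneD eG).
split; apply/asboolP; exists e1 => //; split=> //.
by rewrite latvD; apply: (coneD e1G).
Qed.

(** The face condition on [c1] holds both when [c1] is a face of [c] and when it is a cone of [G];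
    the former serves the sheaf restrictions, the latter the comparison map. *)
Lemma star_restrict c c1 u m :
    c1 `<=` c -> (forall e, e \in cones G -> e `<=` c -> face (e `&` c1) e) ->
  [/\ c (latv R u), star_nonzero G c u m & c1 (latv R (u + m))] <->
  [/\ c1 (latv R u), star_nonzero G c1 u m & c1 (latv R (u + m))].
Proof.
move=> c1c fc1; split=> -[cu /asboolP[e eG [ec eu em]] hum]; last first.
  by split=> //; [apply: c1c|apply/asboolP; exists e => //; split=> //; apply: subset_trans c1c].
have fe := fc1 e eG ec.
have [[_ c1u] [_ c1m]] : (e `&` c1) (latv R u) /\ (e `&` c1) (latv R m).
  apply: (face_addP fe) => //; rewrite -latvD; split=> //.
  by rewrite latvD; apply: (coneD eG).
split=> //; apply/asboolP; exists (e `&` c1); first exact: face_cones fe.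
by split=> //; apply: subIsetr.
Qed.

End Star.

(** * The twisted de Rham differential *)

Section Differential.
Variables (R : realType) (d : nat) (G G' : stacky_fan R d) (gc g : laurent R d).
Local Notation V := 'rV[R]_d.
Local Notation idx := ('rV[int]_d * 'rV[int]_d * {set 'I_d})%type.
Local Notation C := R[i].
Local Notation ext := (ext R d).
Implicit Types (m n u v : 'rV[int]_d) (w : ext).

Local Notation dR_dif b b' :=
  (@lin_ext R d b b' (face_tensor b b') (dR_dif_mono G G' gc g b b')).

Definition mul_cond (F : stacky_fan R d) (c : set V) u m : bool :=
  (latv R u \in c) && star_nonzero F c u m.

(* [me m n w] stands for x^m y^n (x) w.  The target is an arbitrary module so  *)
(* that the identities below also apply to restrictions of the differential.  *)
Section AbstractDifferential.
Variables (W : lmodType C) (me : 'rV[int]_d -> 'rV[int]_d -> ext -> W).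
Hypothesis me_comb : forall m n (a : {set 'I_d} -> C) (h : {set 'I_d} -> ext) w,
  (forall K, w K = \sum_J a J * h J K) -> me m n w = \sum_J a J *: me m n (h J).
Variables c c' : set V.

Definition dif_ext m n w : W :=
  \sum_(u <- msupp gc | mul_cond G c u m) gc@_u *: me (u + m) n (contract u w)
  + \sum_(v <- msupp g | mul_cond G' c' v n) g@_v *: me m (v + n) (wedge v w)
  + me m n (wedge n w).

Lemma dif_extE m n w :
  dif_ext m n w = \sum_J w J *: dif_ext m n (ext_basis R J).
Proof.
rewrite /dif_ext scale_sum3; congr (_ + _ + _).
- apply: eq_bigr => u _; congr (_ *: _).
  by apply: me_comb => K; apply: contract_basisE.
- apply: eq_bigr => v _; congr (_ *: _).
  by apply: me_comb => K; apply: wedge_basisE.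
- by apply: me_comb => K; apply: wedge_basisE.
Qed.

Hypothesis meD : forall m n w w', me m n (w + w') = me m n w + me m n w'.

Lemma me0 m n : me m n 0 = 0.
Proof. by apply: (addrI (me m n 0)); rewrite -meD !addr0. Qed.

Lemma meN m n w : me m n (- w) = - me m n w.
Proof. by apply/eqP; rewrite -addr_eq0 -meD addNr me0. Qed.

Variable D : W -> W.
Hypothesis lD : linear D.
Hypothesis D_me : forall m n w, c (latv R m) -> c' (latv R n) ->
  D (me m n w) = dif_ext m n w.
Hypothesis cD : forall x y, c x -> c y -> c (x + y).
Hypothesis cD' : forall x y, c' x -> c' y -> c' (x + y).
Hypothesis cc' : orthogonal c c'.

Lemma wedge_sqr v w : wedge v (wedge v w) = 0.
Proof.
have h := wedge_anticomm v v w; apply/ffunP => J; rewrite [RHS]ffunE.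
have /eqP : wedge v (wedge v w) J *+ 2 = 0.
  by rewrite mulr2n {1}h ffunE addNr.
by rewrite mulrn_eq0 => /eqP.
Qed.

Lemma contract_wedge_orth u v w : c (latv R u) -> c' (latv R v) ->
  contract u (wedge v w) = - wedge v (contract u w).
Proof.
move=> cu cv; apply/ffunP => J; rewrite [RHS]ffunE.
by apply/eqP; rewrite -addr_eq0 contract_wedge (orthogonal_lattice cc') // mul0r.
Qed.

Lemma mul_cond_assoc (F : stacky_fan R d) (b : set V) u v m :
  mul_cond F b u m -> mul_cond F b v (u + m) -> mul_cond F b v m /\ mul_cond F b u (v + m).
Proof.
move=> /andP[bu sm] /andP[bv sum]; have [s1 s2] := star_assoc sm sum.
by rewrite /mul_cond bu bv.
Qed.

(* Associativity and commutativity of the face algebra product make the       *)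
(* double sum antisymmetric in its two indices.                               *)
Lemma antisym_double_sum (F : stacky_fan R d) (b : set V) (f : laurent R d) m
    (h : 'rV[int]_d -> 'rV[int]_d -> W) :
  (forall u v, h u v = - h v u) ->
  \sum_(u <- msupp f | mul_cond F b u m) f@_u *:
    (\sum_(v <- msupp f | mul_cond F b v (u + m)) f@_v *: h v u) = 0.
Proof.
move=> hN; apply: eqN_eq0.
pose k u v := if mul_cond F b u m && mul_cond F b v (u + m) then
  (f@_u * f@_v) *: h v u else 0.
have E : \sum_(u <- msupp f | mul_cond F b u m) f@_u *:
    (\sum_(v <- msupp f | mul_cond F b v (u + m)) f@_v *: h v u) =
    \sum_(u <- msupp f) \sum_(v <- msupp f) k u v.
  rewrite big_mkcond; apply: eq_bigr => u _; rewrite /k; case: ifP => hu /=; last by rewrite big1.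
  rewrite scaler_sumr big_mkcond; apply: eq_bigr => v _.
  by case: ifP => //; rewrite scalerA.
rewrite E [in RHS]exchange_big -sumrN; apply: eq_bigr => u _; rewrite -sumrN.
apply: eq_bigr => v _; rewrite /k.
have -> : mul_cond F b v m && mul_cond F b u (v + m) =
          mul_cond F b u m && mul_cond F b v (u + m).
  by apply/idP/idP => /andP[h1 h2]; apply/andP; apply: (mul_cond_assoc h1 h2).
by case: ifP => _; rewrite ?oppr0 // hN scalerN mulrC.
Qed.

(** The squares of the contraction and wedge parts vanish by antisymmetry. Contraction anticommutes
    with both wedge parts, since the Clifford relation has zero right-hand side on orthogonal
    cones. *)
Lemma dif_ext_dif m n w : c (latv R m) -> c' (latv R n) -> D (dif_ext m n w) = 0.
Proof.
move=> cm cn; rewrite /dif_ext !(linear_propD lD) !(linear_prop_sum lD).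
have EA : \sum_(u <- msupp gc | mul_cond G c u m) D (gc@_u *: me (u + m) n (contract u w)) =
  \sum_(u <- msupp gc | mul_cond G c u m) gc@_u *: dif_ext (u + m) n (contract u w).
  apply: eq_bigr => u /andP[/set_mem cu _]; rewrite (linear_propZ lD) D_me //.
  by rewrite latvD; apply: cD.
have EB : \sum_(v <- msupp g | mul_cond G' c' v n) D (g@_v *: me m (v + n) (wedge v w)) =
  \sum_(v <- msupp g | mul_cond G' c' v n) g@_v *: dif_ext m (v + n) (wedge v w).
  apply: eq_bigr => u /andP[/set_mem cu _]; rewrite (linear_propZ lD) D_me //.
  by rewrite latvD; apply: cD'.
rewrite EA EB D_me // /dif_ext.
under eq_bigr do rewrite !scalerDr.
under [X in _ + X + _]eq_bigr do rewrite !scalerDr.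
rewrite !big_split /=.
rewrite (antisym_double_sum G c gc m
  (h := fun v u => me (v + (u + m)) n (contract v (contract u w)))); last first.
  by move=> u v; rewrite contract_anticomm meN addrCA.
rewrite (antisym_double_sum G' c' g n
  (h := fun v u => me m (v + (u + n)) (wedge v (wedge u w)))); last first.
  by move=> u v; rewrite wedge_anticomm meN addrCA.
rewrite wedge_sqr me0 !addr0 add0r.
set AB := \sum_(u <- _ | _) _ *: (\sum_(v <- _ | _) _); set AE := \sum_(u <- _ | _) _.
set BA := \sum_(u <- _ | _) _ *: (\sum_(v <- _ | _) _); set BE := \sum_(u <- _ | _) _.
set EA' := \sum_(u <- _ | _) _; set EB' := \sum_(u <- _ | _) _.
have h1 : AB + BA = 0.
  rewrite /BA; under eq_bigr do rewrite scaler_sumr.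
  rewrite exchange_big -big_split big1 //= => u /andP[/set_mem cu _].
  rewrite scaler_sumr -big_split big1 //= => v /andP[/set_mem cv _].
  rewrite contract_wedge_orth // meN !scalerN !scalerA mulrC.
  by rewrite subrr.
have h2 : AE + EA' = 0.
  rewrite -big_split big1 //= => u /andP[/set_mem cu _].
  by rewrite contract_wedge_orth // meN scalerN subrr.
(* After multiplication by y^v the last part of D wedges with v + n; the summand v dies against the
   wedge by v, and the summand n anticommutes with it. *)
have h3 : BE + EB' = 0.
  rewrite -big_split big1 //= => v _.
  by rewrite wedgeDl wedge_sqr add0r wedge_anticomm meN scalerN addNr.
have -> : AB + AE + (BA + BE) + (EA' + EB') = (AB + BA) + ((AE + EA') + (BE + EB')).
  by rewrite [AB + AE + _]addrACA -[LHS]addrA; congr (_ + _); apply: addrACA.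
by rewrite h1 h2 h3 !addr0.
Qed.

End AbstractDifferential.

Lemma dif_ext_morph (W W1 : lmodType C) (me : 'rV[int]_d -> 'rV[int]_d -> ext -> W)
    (me1 : 'rV[int]_d -> 'rV[int]_d -> ext -> W1) (t : W -> W1) c c' m n w :
  linear t -> (forall m n w, t (me m n w) = me1 m n w) ->
  t (dif_ext me c c' m n w) = dif_ext me1 c c' m n w.
Proof.
move=> lt tme; rewrite /dif_ext !(linear_propD lt) !(linear_prop_sum lt) tme.
by congr (_ + _ + _); apply: eq_bigr => u _; rewrite (linear_propZ lt) tme.
Qed.

Lemma dif_ext_subspace (W : lmodType C) (me : 'rV[int]_d -> 'rV[int]_d -> ext -> W)
    c c' (Q : W -> Prop) m n w :
    Q 0 -> (forall k x y, Q x -> Q y -> Q (k *: x + y)) ->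
    (forall u, u \in msupp gc -> c (latv R u) -> Q (me (u + m) n (contract u w))) ->
    (forall v, v \in msupp g -> c' (latv R v) -> Q (me m (v + n) (wedge v w))) ->
    Q (me m n (wedge n w)) ->
  Q (dif_ext me c c' m n w).
Proof.
move=> Q0 QD QA QB QE.
have QDD x y : Q x -> Q y -> Q (x + y) by move=> Qx; rewrite -[x]scale1r; apply: QD.
have QZ k x : Q x -> Q (k *: x) by move=> Qx; rewrite -[_ *: _]addr0; apply: QD.
have QS (f : laurent R d) (p : pred 'rV[int]_d) (h : 'rV[int]_d -> W) :
    (forall u, u \in msupp f -> p u -> Q (h u)) ->
    Q (\sum_(u <- msupp f | p u) f@_u *: h u).
  move=> Qh; rewrite big_seq_cond; apply: big_ind => // u /andP[us pu].
  by apply/QZ/Qh.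
apply: (QDD _ _ _ QE); apply: QDD; apply: QS => u us /andP[/set_mem cu _].
  exact: QA.
exact: QB.
Qed.

Section AbstractRestriction.
Variables (W : lmodType C) (me : 'rV[int]_d -> 'rV[int]_d -> ext -> W).
Variables c c' e e' : set V.
Hypothesis me_out : forall m n w, ~ (e (latv R m) /\ e' (latv R n)) -> me m n w = 0.
Hypotheses (ec : e `<=` c) (ec' : e' `<=` c').
Hypothesis fe : forall b, b \in cones G -> b `<=` c -> face (b `&` e) b.
Hypothesis fe' : forall b, b \in cones G' -> b `<=` c' -> face (b `&` e') b.

Lemma mul_cond_restrict (F : stacky_fan R d) (b b1 : set V) u m : b1 `<=` b ->
    (forall a, a \in cones F -> a `<=` b -> face (a `&` b1) a) ->
  b1 (latv R (u + m)) -> mul_cond F b u m = mul_cond F b1 u m.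
Proof.
move=> b1b fb hum; have [h1 h2] := star_restrict u m b1b fb.
apply/idP/idP => /andP[/set_mem hu hs].
  by have [//|hu' hs' _] := h1; apply/andP; split=> //; apply: mem_set.
by have [//|hu' hs' _] := h2; apply/andP; split=> //; apply: mem_set.
Qed.

Lemma dif_ext_restrict m n w : e (latv R m) -> e' (latv R n) ->
  dif_ext me c c' m n w = dif_ext me e e' m n w.
Proof.
move=> em en; rewrite /dif_ext; congr (_ + _ + _).
  rewrite big_mkcond [RHS]big_mkcond; apply: eq_bigr => u _.
  have [hum|hum] := pselect (e (latv R (u + m))).
    by rewrite (mul_cond_restrict ec fe).
  by rewrite me_out ?scaler0 ?if_same // => -[].
rewrite big_mkcond [RHS]big_mkcond; apply: eq_bigr => v _.
have [hvn|hvn] := pselect (e' (latv R (v + n))).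
  by rewrite (mul_cond_restrict ec' fe').
by rewrite me_out ?scaler0 ?if_same // => -[].
Qed.

Lemma mul_cond_face (F : stacky_fan R d) (b b1 : set V) u m :
    (forall a, a \in cones F -> a `<=` b -> face (a `&` b1) a) ->
  mul_cond F b u m -> b1 (latv R (u + m)) -> b1 (latv R m).
Proof.
move=> fb /andP[_ /asboolP[a aF [ab au am]]]; rewrite latvD => hum.
have [_ []//] : (a `&` b1) (latv R u) /\ (a `&` b1) (latv R m).
by apply: (face_addP (fb a aF ab)) => //; split=> //; apply: (coneD aF).
Qed.

(** A product landing in [e] or [e'] already has its factor x^m or y^n there, so the kernel of
    truncation is stable under D. *)
Lemma dif_ext_out m n w : ~ (e (latv R m) /\ e' (latv R n)) ->
  dif_ext me c c' m n w = 0.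
Proof.
move=> out; rewrite /dif_ext (me_out _ out) addr0 !big1 ?addr0 // => u hu.
  rewrite me_out ?scaler0 // => -[h1 h2]; apply: out; split=> //.
  exact: mul_cond_face fe' hu h2.
rewrite me_out ?scaler0 // => -[h1 h2]; apply: out; split=> //.
exact: mul_cond_face fe hu h1.
Qed.

End AbstractRestriction.

Section OneCone.
Variables c c' : set V.
Local Notation me := (mono_ext c c').

Lemma mono_ext_comb m n (a : {set 'I_d} -> C) (h : {set 'I_d} -> ext) w :
  (forall K, w K = \sum_J a J * h J K) -> me m n w = \sum_J a J *: me m n (h J).
Proof.
move=> wE; rewrite /mono_ext.
transitivity (\sum_K \sum_J (a J * h J K) *: mono c c' (m, n, K)).
  by apply: eq_bigr => K _; rewrite wE scaler_suml.
rewrite exchange_big; apply: eq_bigr => J _; rewrite scaler_sumr.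
by apply: eq_bigr => K _; rewrite scalerA.
Qed.

Lemma mono_extD m n w w' : me m n (w + w') = me m n w + me m n w'.
Proof.
by rewrite /mono_ext -big_split; apply: eq_bigr => J _; rewrite ffunE scalerDl.
Qed.

Lemma mono_ext_basis m n J : me m n (ext_basis R J) = mono c c' (m, n, J).
Proof.
rewrite /mono_ext (bigD1 J) //= ffunE eqxx scale1r big1 ?addr0 // => I IJ.
by rewrite ffunE (negPf IJ) scale0r.
Qed.

Lemma mono_ext_out m n w : ~ (c (latv R m) /\ c' (latv R n)) -> me m n w = 0.
Proof.
move=> out; rewrite /mono_ext big1 // => J _; rewrite mono_out ?scaler0 //.
by apply/in_conesP.
Qed.

Local Notation D := (dR_dif c c').

Lemma dR_dif_monoE m n J :
  dR_dif_mono G G' gc g c c' (m, n, J) = dif_ext me c c' m n (ext_basis R J).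
Proof. by []. Qed.

Lemma dR_dif_mono_ext m n w : c (latv R m) -> c' (latv R n) ->
  D (me m n w) = dif_ext me c c' m n w.
Proof.
move=> cm cn; rewrite dif_extE; last exact: mono_ext_comb.
rewrite /mono_ext linear_prop_sum; last exact: lin_ext_linear.
apply: eq_bigr => J _; rewrite linear_propZ; last exact: lin_ext_linear.
by rewrite lin_ext_mono //; apply/in_conesP.
Qed.

Lemma dR_dif_dif (x : face_tensor c c') :
    (forall x y, c x -> c y -> c (x + y)) -> (forall x y, c' x -> c' y -> c' (x + y)) ->
    orthogonal c c' ->
  D (D x) = 0.
Proof.
move=> cD cD' cc'; have lD : linear D by exact: lin_ext_linear.
move: x; apply: (mono_span (f := fun x => D (D x)) (g := fun=> 0)).
- by move=> a x y; rewrite !lD.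
- by move=> a x y; rewrite scaler0 addr0.
move=> [[m n] J] /in_conesP[/= cm cn].
rewrite -mono_ext_basis dR_dif_mono_ext //.
apply: dif_ext_dif => // [m' n' w w'|m' n' w]; [exact: mono_extD|exact: dR_dif_mono_ext].
Qed.

End OneCone.

Lemma truncate_mono_ext c c' e e' m n w : e `<=` c -> e' `<=` c' ->
  truncate e e' (mono_ext c c' m n w) = mono_ext e e' m n w.
Proof.
move=> ec e'c'; rewrite /mono_ext linear_prop_sum; last exact: truncate_linear.
apply: eq_bigr => J _; rewrite linear_propZ; last exact: truncate_linear.
by rewrite truncate_mono.
Qed.

Lemma truncate_dR_dif (c c' e e' : set V) (x : face_tensor c c') :
    e `<=` c -> e' `<=` c' ->
    (forall b, b \in cones G -> b `<=` c -> face (b `&` e) b) ->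
    (forall b, b \in cones G' -> b `<=` c' -> face (b `&` e') b) ->
  truncate e e' (dR_dif c c' x) =
  dR_dif e e' (truncate e e' x).
Proof.
move=> ec e'c' fe fe'.
have lt : linear (@truncate R d c c' e e') by exact: truncate_linear.
have lD b b' : linear (dR_dif b b') by exact: lin_ext_linear.
move: x; apply: mono_span.
- by move=> a x y; rewrite lD lt.
- by move=> a x y; rewrite lt lD.
move=> [[m n] J] hz; rewrite lin_ext_mono // truncate_mono // dR_dif_monoE.
rewrite (dif_ext_morph (me1 := mono_ext e e')) //; last first.
  by move=> m' n' w; apply: truncate_mono_ext.
have [[em en]|out] := pselect (e (latv R m) /\ e' (latv R n)).
  rewrite -mono_ext_basis dR_dif_mono_ext //; apply: dif_ext_restrict => // *.
  exact: mono_ext_out.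
rewrite mono_out; last by apply/in_conesP.
rewrite (linear_prop0 (lD _ _)); apply: (@dif_ext_out _ _ c c' e e') => // *.
exact: mono_ext_out.
Qed.

Lemma mono_ext_supp (c c' : set V) m n w (P : idx -> Prop) :
    (forall K, w K != 0 -> P (m, n, K)) ->
  forall z, coef (mono_ext c c' m n w) z != 0 -> P z.
Proof.
move=> Pw z; rewrite /mono_ext coef_sum => nz.
have [[K [wK <-]]|none] := pselect (exists K, w K != 0 /\ (m, n, K) = z).
  exact: Pw.
case/eqP: nz; rewrite big1 // => K _; rewrite coefZ coef_mono.
have [wK0|wK] := eqVneq (w K) 0; first by rewrite wK0 mul0r.
have [e|ne] := eqVneq (m, n, K) z; last by rewrite andbF mulr0.
by case: none; exists K.
Qed.

(** Degree and filtration depend only on which monomials occur; the three hypotheses match the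
    contraction, the wedge by exponents of [g] and the wedge by n. *)
Lemma dR_dif_mono_supp (c c' : set V) m n (J : {set 'I_d}) (P : idx -> Prop) :
    (forall u (K : {set 'I_d}), u \in msupp gc -> c (latv R u) -> #|J| = #|K|.+1 ->
      P (u + m, n, K)) ->
    (forall v (K : {set 'I_d}), v \in msupp g -> c' (latv R v) -> #|K| = #|J|.+1 ->
      P (m, v + n, K)) ->
    (forall K : {set 'I_d}, #|K| = #|J|.+1 -> P (m, n, K)) ->
  forall z, coef (dR_dif_mono G G' gc g c c' (m, n, J)) z != 0 -> P z.
Proof.
move=> PA PB PE; rewrite dR_dif_monoE.
apply: (dif_ext_subspace (Q := fun x : face_tensor c c' => forall z, coef x z != 0 -> P z)).
- by move=> z; rewrite coef0 eqxx.
- move=> k x y Px Py z; rewrite coef_linear.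
  have [x0|/Px//] := eqVneq (coef x z) 0; have [y0|/Py//] := eqVneq (coef y z) 0.
  by rewrite x0 y0 mulr0 addr0 eqxx.
- move=> u us cu; apply: mono_ext_supp => K /contract_basis_supp; exact: PA.
- move=> v vs cv; apply: mono_ext_supp => K /wedge_basis_supp; exact: PB.
- by apply: mono_ext_supp => K /wedge_basis_supp; apply: PE.
Qed.

End Differential.

(** * The Godement resolution *)

(** Pairs (i, j) with i <= j are matched with the pairs (j + 1, i), which carry the opposite
    sign. *)
Lemma alternating_double_sum (K : pzRingType) (W : lmodType K) n
    (X : 'I_n.+1 -> 'I_n -> W) :
    (forall i j : 'I_n, (i <= j)%N -> X (widen_ord (leqnSn n) i) j = X (lift ord0 j) i) ->
  \sum_(i < n.+1) \sum_(j < n) ((-1) ^+ i * (-1) ^+ j) *: X i j = 0.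
Proof.
move=> Xsym; under eq_bigr => i _ do rewrite (bigID (fun j : 'I_n => (j < i)%N)) /=.
rewrite big_split /= big_ord_recl big_pred0 ?add0r => [|j]; last by rewrite ltn0.
rewrite [X in _ + X](exchange_big_dep predT) //= -big_split big1 //= => j _.
rewrite [X in _ + X]big_mkcond big_ord_recr /= ltn_ord /= addr0 -big_mkcond /=.
rewrite [X in _ + X](eq_bigl (fun i : 'I_n => (i < j.+1)%N)) => [|i]; last by rewrite -leqNgt ltnS.
rewrite -big_split big1 //= => i ij.
rewrite Xsym; last by rewrite -ltnS.
by rewrite -scalerDl /bump leq0n add1n exprS mulN1r mulNr -!exprD addnC addNr scale0r.
Qed.

Section Subspaces.
Variables (K : nzRingType) (W : lmodType K) (A : set W).
Hypothesis subA : subspace A.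

Lemma subspace0 : A 0. Proof. by case: subA. Qed.

Lemma subspaceD x y : A x -> A y -> A (x + y).
Proof. by case: subA => _ h Ax Ay; rewrite -[x]scale1r; apply: h. Qed.

Lemma subspaceZ k x : A x -> A (k *: x).
Proof. by case: subA => A0 h Ax; rewrite -[_ *: _]addr0; apply: h. Qed.

Lemma subspaceB x y : A x -> A y -> A (x - y).
Proof. by move=> Ax Ay; apply: subspaceD => //; rewrite -scaleN1r; apply: subspaceZ. Qed.

Lemma subspace_sum I (r : seq I) (P : pred I) (F : I -> W) :
  (forall i, P i -> A (F i)) -> A (\sum_(i <- r | P i) F i).
Proof. by move=> h; apply: big_ind => //; [apply: subspace0|apply: subspaceD]. Qed.

End Subspaces.

Section Godement.
Variables (K : nzRingType) (R : realType).
Variables (T : finType) (le : rel T) (T' : finType) (le' : rel T') (pi : T -> T').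
Variable F : fcx_sheaf K R T.
Local Notation chain := (chain le le' pi).

Definition cochain (eta : T') (p : nat) : lmodType K :=
  dprod (fun s : chain eta p => stalk F (last_cone s)).

Definition cech_dif eta p (x : cochain eta p) : cochain eta p.+1 :=
  fun s => \sum_(i < p.+2) (-1) ^+ i *: res (last_cone s) (x (chain_omit s i)).

Definition cochain_dif eta p (x : cochain eta p) : cochain eta p :=
  fun s => dif (x s).

Local Notation D f := (@Rpush_dif K R T le T' le' pi F _ f).
Local Notation Dat f p := (@Rpush_dif K R T le T' le' pi F _ f p).

Lemma Rpush_dif0 eta (f : Rpush_stalk le le' pi F eta) : Dat f 0%N = cochain_dif (f 0%N).
Proof. by []. Qed.

Lemma Rpush_difS eta (f : Rpush_stalk le le' pi F eta) q :
  Dat f q.+1 = cech_dif (f q) + (-1) ^+ q.+1 *: cochain_dif (f q.+1).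
Proof. by []. Qed.

Lemma chain_le eta p (s : chain eta p) (i j : 'I_p.+1) :
  (i <= j)%N -> le (val s j) (val s i).
Proof. by have /andP[_ /forallP/(_ i)/forallP/(_ j)/implyP] := valP s. Qed.

Lemma chain_in eta p (s : chain eta p) (i : 'I_p.+1) : le' (pi (val s i)) eta.
Proof. by have /andP[/forallP/(_ i)] := valP s. Qed.

Lemma chain_last_in eta p (s : chain eta p) : le' (pi (last_cone s)) eta.
Proof. exact: chain_in. Qed.

Lemma chain_omit_le eta p (s : chain eta p.+1) i : le (last_cone s) (last_cone (chain_omit s i)).
Proof. by rewrite /last_cone /= ffunE chain_le // leq_ord. Qed.

Lemma chain_omit_omit eta p (s : chain eta p.+2) (i j : 'I_p.+2) : (i <= j)%N ->
  chain_omit (chain_omit s (widen_ord (leqnSn _) i)) j = chain_omit (chain_omit s (lift ord0 j)) i.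
Proof.
move=> ij; apply: val_inj; apply/ffunP => k; rewrite !ffunE; congr (val s _).
apply: val_inj; rewrite /= /bump /=; case: (leqP j k) (leqP i k) => hj hi; lia.
Qed.

Hypothesis Fsh : is_fcx_sheaf le F.

Lemma cech_dif_linear eta p : linear (@cech_dif eta p).
Proof.
move=> a x y; apply: functional_extensionality_dep => s.
rewrite /cech_dif; transitivity (a *: (\sum_(i < p.+2) (-1) ^+ i *:
   res (last_cone s) (x (chain_omit s i))) + \sum_(i < p.+2) (-1) ^+ i *:
   res (last_cone s) (y (chain_omit s i))) => //.
rewrite scaler_sumr -big_split; apply: eq_bigr => i _ /=.
have -> : (a *: x + y) (chain_omit s i) = a *: x (chain_omit s i) + y (chain_omit s i) by [].
rewrite (res_linear Fsh (chain_omit_le s i)) scalerDr !scalerA.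
by rewrite -signr_odd; case: (odd i); rewrite ?expr0 ?expr1 ?mul1r ?mulr1 ?mulN1r ?mulrN1.
Qed.

Lemma cochain_dif_linear eta p : linear (@cochain_dif eta p).
Proof.
move=> a x y; apply: functional_extensionality_dep => s.
exact: (dif_linear Fsh).
Qed.

Lemma cech_cech eta p (x : cochain eta p) : cech_dif (cech_dif x) = 0.
Proof.
apply: functional_extensionality_dep => s.
transitivity (\sum_(i < p.+3) \sum_(j < p.+2) ((-1) ^+ i * (-1) ^+ j) *:
    res (last_cone s) (x (chain_omit (chain_omit s i) j))); last first.
  by apply: alternating_double_sum => i j ij; rewrite chain_omit_omit.
rewrite {1}/cech_dif; apply: eq_bigr => i _.
have lr := res_linear Fsh (chain_omit_le s i).
rewrite (linear_prop_sum lr) scaler_sumr; apply: eq_bigr => j _.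
by rewrite (linear_propZ lr) scalerA (res_comp Fsh) // chain_omit_le.
Qed.

Lemma cech_cochain_dif eta p (x : cochain eta p) :
  cech_dif (cochain_dif x) = cochain_dif (cech_dif x).
Proof.
apply: functional_extensionality_dep => s; rewrite /cech_dif /cochain_dif.
have ld := @dif_linear _ _ _ _ _ Fsh (last_cone s).
rewrite (linear_prop_sum ld); apply: eq_bigr => i _.
by rewrite (linear_propZ ld) (dif_res Fsh) // chain_omit_le.
Qed.

Lemma cochain_dif_dif eta p (x : cochain eta p) : cochain_dif (cochain_dif x) = 0.
Proof. by apply: functional_extensionality_dep => s; apply: (dif_dif Fsh). Qed.

Lemma Rpush_dif_linear eta : linear (@Rpush_dif K R T le T' le' pi F eta).
Proof.
move=> a f g; apply: functional_extensionality_dep => -[|q].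
  exact: cochain_dif_linear.
transitivity (cech_dif (a *: f q + g q) +
    (-1) ^+ q.+1 *: cochain_dif (a *: f q.+1 + g q.+1)) => //.
rewrite cech_dif_linear cochain_dif_linear.
transitivity (a *: (Dat f q.+1 : cochain eta q.+1) + Dat g q.+1) => //.
rewrite !Rpush_difS scalerDr !scalerDr addrACA !scalerA.
by rewrite -signr_odd; case: (odd _); rewrite ?expr0 ?expr1 ?mul1r ?mulr1 ?mulN1r ?mulrN1.
Qed.

Lemma Rpush_dif_dif eta (f : Rpush_stalk le le' pi F eta) : D (D f) = 0.
Proof.
apply: functional_extensionality_dep => -[|q]; first exact: cochain_dif_dif.
have lc := cochain_dif_linear (eta := eta) (p := q.+1).
rewrite !Rpush_difS (linear_propD lc) (linear_propZ lc) cochain_dif_dif scaler0 addr0.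
case: q lc => [|q] lc; first by rewrite Rpush_dif0 cech_cochain_dif expr1 scaleN1r subrr.
have lh := cech_dif_linear (eta := eta) (p := q.+1).
rewrite Rpush_difS (linear_propD lh) (linear_propZ lh) cech_cech add0r cech_cochain_dif.
by rewrite -scalerDl [(-1) ^+ q.+2]exprS mulN1r subrr scale0r.
Qed.

(** Replaces the [insub] in the restriction by any chain through the same cones. *)
Lemma Rpush_resE eta eta' (f : Rpush_stalk le le' pi F eta) p (s : chain eta' p)
    (t : chain eta p) : val t = val s ->
  @Rpush_res K R T le T' le' pi F eta eta' f p s = res (last_cone s) (f p t).
Proof.
move=> ts; rewrite /Rpush_res; case: insubP => [t' _ t's|].
  by have -> : t' = t by apply: val_inj; rewrite ts.
by rewrite -ts (valP t).
Qed.

Hypothesis le_refl : reflexive le.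
Hypothesis le'_trans : transitive le'.

Lemma chain_widen eta eta' p (s : chain eta' p) : le' eta' eta ->
  exists t : chain eta p, val t = val s.
Proof.
move=> ee; suff h : is_chain le le' pi eta (val s) by exists (Sub _ h).
apply/andP; split; last by have /andP[] := valP s.
by apply/forallP => i; apply: le'_trans ee; apply: chain_in.
Qed.

Lemma chain_last_le eta eta' p (s : chain eta' p) (t : chain eta p) : val t = val s ->
  le (last_cone s) (last_cone t).
Proof. by rewrite /last_cone => ->. Qed.

Lemma chain_omit_val eta eta' p (s : chain eta' p.+1) (t : chain eta p.+1) i :
  val t = val s -> val (chain_omit t i) = val (chain_omit s i).
Proof. by move=> ts; rewrite /= ts. Qed.

Lemma Rpush_gr_subspace eta del : subspace (@Rpush_gr K R T le T' le' pi F eta del).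
Proof.
split=> [p s|k f g hf hg p s]; first by case: (gr_subspace Fsh (last_cone s) (del - p%:R)).
by case: (gr_subspace Fsh (last_cone s) (del - p%:R)) => _; apply.
Qed.

Lemma Rpush_fil_subspace eta lam : subspace (@Rpush_fil K R T le T' le' pi F eta lam).
Proof.
split=> [p s|k f g hf hg p s]; first by case: (fil_subspace Fsh (last_cone s) lam).
by case: (fil_subspace Fsh (last_cone s) lam) => _; apply.
Qed.

Lemma Rpush_is_fcx_sheaf : is_fcx_sheaf le' (Rpush le le' pi F).
Proof.
split.
- move=> a b ba k f g; apply: functional_extensionality_dep => p.
  apply: functional_extensionality_dep => s; have [t ts] := chain_widen s ba.
  transitivity (k *: @Rpush_res K R T le T' le' pi F a b f p s +
    @Rpush_res K R T le T' le' pi F a b g p s) => //.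
  rewrite /= !(Rpush_resE _ ts).
  exact: (res_linear Fsh (chain_last_le ts)).
- move=> a f; apply: functional_extensionality_dep => p.
  apply: functional_extensionality_dep => s.
  by rewrite /= (@Rpush_resE _ _ f _ s s) // (res_id Fsh).
- move=> a b c f ba cb; apply: functional_extensionality_dep => p.
  apply: functional_extensionality_dep => s; have [t ts] := chain_widen s cb.
  have [u ut] := chain_widen t ba.
  rewrite /= (Rpush_resE _ ts) (Rpush_resE _ ut) (Rpush_resE _ (etrans ut ts)).
  by rewrite (res_comp Fsh) // chain_last_le.
- exact: Rpush_dif_linear.
- exact: Rpush_dif_dif.
- move=> a b f ba; apply: functional_extensionality_dep => p.
  apply: functional_extensionality_dep => s; have [t ts] := chain_widen s ba.
  have lr := res_linear Fsh (chain_last_le ts).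
  case: p s t ts lr => [|q] s t ts lr /=.
    by rewrite (Rpush_resE _ ts) (dif_res Fsh) ?chain_last_le // (Rpush_resE _ ts).
  transitivity (res (last_cone s) (Dat f q.+1 t)); last by rewrite (Rpush_resE _ ts).
  rewrite /= (linear_propD lr) (linear_prop_sum lr) (linear_propZ lr).
  rewrite (Rpush_resE _ ts) (dif_res Fsh) ?chain_last_le //; congr (_ + _).
  apply: eq_bigr => i _; rewrite (linear_propZ lr); congr (_ *: _).
  rewrite (Rpush_resE _ (chain_omit_val i ts)).
  by rewrite !(res_comp Fsh) ?chain_omit_le ?(chain_last_le (chain_omit_val i ts)) // chain_last_le.
- exact: Rpush_gr_subspace.
- move=> a b del f ba hf p s; have [t ts] := chain_widen s ba.
  by rewrite /= (Rpush_resE _ ts); apply: (gr_res Fsh); [apply: chain_last_le|apply: hf].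
- move=> a del f hf [|q] s.
    by rewrite /= addrAC; apply: (gr_dif Fsh); apply: hf.
  have eq1 : del + 1 - q.+1%:R = del - q%:R :> R by rewrite -natr1; ring.
  have eq2 : del + 1 - q.+1%:R = del - q.+1%:R + 1 :> R by ring.
  apply: subspaceD; first exact: (gr_subspace Fsh).
    apply: subspace_sum => [|i _]; first exact: (gr_subspace Fsh).
    apply: subspaceZ; first exact: (gr_subspace Fsh).
    by apply: (gr_res Fsh); [apply: chain_omit_le|rewrite eq1; apply: hf].
  apply: subspaceZ; first exact: (gr_subspace Fsh).
  by rewrite eq2; apply: (gr_dif Fsh); apply: hf.
- exact: Rpush_fil_subspace.
- by move=> a lam mu lm f hf p s; apply: (fil_decr Fsh lm); apply: hf.
- move=> a b lam f ba hf p s; have [t ts] := chain_widen s ba.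
  by rewrite /= (Rpush_resE _ ts); apply: (fil_res Fsh); [apply: chain_last_le|apply: hf].
- move=> a lam f hf [|q] s; first by apply: (fil_dif Fsh); apply: hf.
  apply: subspaceD; first exact: (fil_subspace Fsh).
    apply: subspace_sum => [|i _]; first exact: (fil_subspace Fsh).
    apply: subspaceZ; first exact: (fil_subspace Fsh).
    by apply: (fil_res Fsh); [apply: chain_omit_le|apply: hf].
  apply: subspaceZ; first exact: (fil_subspace Fsh).
  by apply: (fil_dif Fsh); apply: hf.
Qed.

End Godement.

(** * From exact rows to a filtered quasi-isomorphism *)

Section Augmentation.
Variables (K : nzRingType) (R : realType).
Variables (T : finType) (le : rel T) (T' : finType) (le' : rel T') (pi : T -> T').
Variables (F : fcx_sheaf K R T) (C : fcx_sheaf K R T').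
Variable sec : forall eta : T', stalk C eta -> forall gam : T, stalk F gam.
Local Notation chain := (chain le le' pi).
Local Notation cochain := (cochain le le' pi F).

Definition augmentation eta (x : stalk C eta) : stalk (Rpush le le' pi F) eta :=
  @Rpush_aug K R T le T' le' pi F eta (sec x).

Hypothesis Fsh : is_fcx_sheaf le F.
Hypothesis le_refl : reflexive le.
Hypothesis le'_trans : transitive le'.
Hypothesis sec_linear : forall eta gam, linear (fun x : stalk C eta => sec x gam).
Hypothesis sec_face : forall eta (x : stalk C eta) gam gam', le' (pi gam) eta ->
  le gam' gam -> res gam' (sec x gam) = sec x gam'.
Hypothesis sec_res : forall eta eta' (x : stalk C eta) gam, le' eta' eta ->
  le' (pi gam) eta' -> sec (res eta' x) gam = sec x gam.
Hypothesis sec_dif : forall eta (x : stalk C eta) gam, le' (pi gam) eta ->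
  sec (dif x) gam = dif (sec x gam).
Hypothesis sec_gr : forall eta del (x : stalk C eta) gam, le' (pi gam) eta ->
  gr del x -> gr del (sec x gam).
Hypothesis sec_fil : forall eta lam (x : stalk C eta) gam, le' (pi gam) eta ->
  fil lam x -> fil lam (sec x gam).

Lemma augmentation_linear eta : linear (@augmentation eta).
Proof.
move=> a x y; apply: functional_extensionality_dep => -[|q];
  apply: functional_extensionality_dep => s; first exact: sec_linear.
transitivity (a *: (0 : stalk F (last_cone s)) + 0) => //.
by rewrite scaler0 addr0.
Qed.

Lemma augmentation_dif eta (x : stalk C eta) :
  augmentation (dif x) = Rpush_dif (augmentation x).
Proof.
apply: functional_extensionality_dep => -[|q];
  apply: functional_extensionality_dep => s /=.
  by rewrite /augmentation /= sec_dif // chain_last_in.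
rewrite (linear_prop0 (@dif_linear _ _ _ _ _ Fsh _)) scaler0 addr0.
case: q s => [|q] s /=; last first.
  apply/esym/big1 => i _.
  by rewrite (linear_prop0 (res_linear Fsh (chain_omit_le _ _))) scaler0.
rewrite big_ord_recl big_ord1 /= expr0 scale1r expr1 scaleN1r.
by rewrite !sec_face ?chain_omit_le ?subrr // chain_last_in.
Qed.

Lemma augmentation_morphism :
  is_filtered_morphism le' (F := C) (F' := Rpush le le' pi F) augmentation.
Proof.
split=> //.
- exact: augmentation_linear.
- move=> a b x ba; apply: functional_extensionality_dep => p.
  apply: functional_extensionality_dep => s.
  have [t ts] := chain_widen le'_trans s ba.
  rewrite /= (Rpush_resE _ ts); case: p s t ts => [|q] s t ts /=.
    by rewrite sec_res ?chain_last_in // sec_face ?chain_last_in // (chain_last_le le_refl).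
  by rewrite (linear_prop0 (res_linear Fsh (chain_last_le le_refl ts))).
- by move=> a x; rewrite augmentation_dif.
- move=> a del x hx [|q] s /=.
    by rewrite subr0; apply: sec_gr (chain_last_in s) hx.
  exact: (subspace0 (gr_subspace Fsh _ _)).
- move=> a lam x hx [|q] s /=; first by apply: sec_fil (chain_last_in s) hx.
  exact: (subspace0 (fil_subspace Fsh _ _)).
Qed.

Definition single_cochain eta p (y : cochain eta p) : Rpush_stalk le le' pi F eta :=
  fun q => if @eqP _ p q is ReflectT e then ecast q (cochain eta q) e y else 0.

Lemma single_cochainE eta p (y : cochain eta p) :
  (single_cochain y : forall q, cochain eta q) p = y.
Proof. by rewrite /single_cochain; case: eqP => // e; rewrite eq_axiomK. Qed.

Lemma single_cochain_neq eta p q (y : cochain eta p) : p != q ->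
  (single_cochain y : forall q, cochain eta q) q = 0.
Proof. by rewrite /single_cochain; case: eqP. Qed.

Lemma single_cochain_in eta p (y : cochain eta p) (A : forall q, set (cochain eta q)) :
  (forall q, A q 0) -> A p y -> forall q, A q ((single_cochain y : forall q, cochain eta q) q).
Proof. by move=> A0 Ay q; rewrite /single_cochain; case: eqP => [e|_] //; case: q / e. Qed.

Hypothesis sec_inj : forall eta (x : stalk C eta),
  (forall gam, le' (pi gam) eta -> sec x gam = 0) -> x = 0.
Hypothesis gr_neg : forall gam (del : R) (x : stalk F gam), del < 0 -> gr del x -> x = 0.
Hypothesis cech_exact0 : forall eta del lam (y : cochain eta 0),
  (forall s, gr del (y s)) -> (forall s, fil lam (y s)) -> cech_dif y = 0 ->
  exists x : stalk C eta, [/\ gr del x, fil lam x & forall s, y s = sec x (last_cone s)].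
Hypothesis cech_exactS : forall eta p del lam (y : cochain eta p.+1),
  (forall s, gr del (y s)) -> (forall s, fil lam (y s)) -> cech_dif y = 0 ->
  exists z : cochain eta p,
    [/\ forall s, gr del (z s), forall s, fil lam (z s) & cech_dif z = y].

Lemma cech_dif0 eta p : cech_dif (0 : cochain eta p) = 0.
Proof. exact: (linear_prop0 (cech_dif_linear Fsh (eta := eta) (p := p))). Qed.

Lemma cochain_dif0 eta p : cochain_dif (0 : cochain eta p) = 0.
Proof. exact: (linear_prop0 (cochain_dif_linear Fsh (eta := eta) (p := p))). Qed.

(* Peel off the top Cech degree of y with the exact rows, until only the      *)
(* degree 0 part is left, which then is the image of a section.               *)
Lemma total_reduction eta N del lam (y : Rpush_stalk le le' pi F eta) :
    @Rpush_gr K R T le T' le' pi F eta del y -> @Rpush_fil K R T le T' le' pi F eta lam y ->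
    (forall p, @Rpush_dif K R T le T' le' pi F eta y p.+1 = 0) ->
    (forall p, (N < p)%N -> (y : forall p, cochain eta p) p = 0) ->
  exists w : Rpush_stalk le le' pi F eta, exists x : stalk C eta,
    [/\ @Rpush_gr K R T le T' le' pi F eta (del - 1) w,
        @Rpush_fil K R T le T' le' pi F eta lam w, gr del x, fil lam x &
        y - Rpush_dif w = augmentation x].
Proof.
elim: N y => [|N IH] y gry fily dy yN.
  have cy : cech_dif ((y : forall p, cochain eta p) 0%N) = 0.
    have := dy 0%N; rewrite Rpush_difS.
    by rewrite (yN 1%N) // cochain_dif0 scaler0 addr0.
  have [||x [grx filx yx]] := cech_exact0 (del := del) (lam := lam) _ _ cy.
  - by move=> s; have := gry 0%N s; rewrite subr0.
  - exact: fily.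
  exists 0, x; split=> //.
  - exact: (subspace0 (Rpush_gr_subspace le' pi Fsh _ _)).
  - exact: (subspace0 (Rpush_fil_subspace le' pi Fsh _ _)).
  rewrite (linear_prop0 (@Rpush_dif_linear _ _ _ _ _ le' pi _ Fsh eta)) subr0.
  apply: functional_extensionality_dep => -[|q].
    by apply: functional_extensionality_dep => s; rewrite yx.
  by rewrite yN //; apply: functional_extensionality_dep.
have cy : cech_dif ((y : forall p, cochain eta p) N.+1) = 0.
  have := dy N.+1; rewrite Rpush_difS.
  by rewrite (yN N.+2) // cochain_dif0 scaler0 addr0.
have [||z [grz filz zy]] := cech_exactS (del := del - N.+1%:R) (lam := lam) _ _ cy.
- exact: gry.
- exact: fily.
pose w1 := single_cochain z.
have grw1 : @Rpush_gr K R T le T' le' pi F eta (del - 1) w1.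
  apply: (single_cochain_in (A := fun q (u : cochain eta q) => forall s, gr (del - 1 - q%:R) (u s))).
    by move=> q s; apply: (subspace0 (gr_subspace Fsh _ _)).
  (* In Cech degree [N], total degree del - 1 means internal degree del - 1 - N, which is the degree
     of [z]. *)
  by move=> s; rewrite -addrA -opprD nat1r; apply: grz.
have filw1 : @Rpush_fil K R T le T' le' pi F eta lam w1.
  apply: (single_cochain_in (A := fun q (u : cochain eta q) => forall s, fil lam (u s))) => //.
  by move=> q s; apply: (subspace0 (fil_subspace Fsh _ _)).
have ddw := Rpush_dif_dif Fsh w1.
have lD := @Rpush_dif_linear _ _ _ _ _ le' pi _ Fsh eta.
have [||||w2 [x [grw2 filw2 grx filx yx]]] := IH (y - Rpush_dif w1).
- apply: (subspaceB (Rpush_gr_subspace le' pi Fsh _ _)) => //.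
  have := gr_dif (Rpush_is_fcx_sheaf pi Fsh le_refl le'_trans) (a := eta) (del := del - 1) (x := w1).
  by rewrite subrK; apply.
- apply: (subspaceB (Rpush_fil_subspace le' pi Fsh _ _)) => //.
  exact: (fil_dif (Rpush_is_fcx_sheaf pi Fsh le_refl le'_trans) (a := eta) (x := w1)).
- by move=> p; rewrite (linear_propD lD) (linear_propN lD) ddw subr0.
- move=> p Np.
  transitivity ((y : forall p, cochain eta p) p - @Rpush_dif K R T le T' le' pi F eta w1 p) => //.
  case: p Np => // p; rewrite ltnS => Np; rewrite Rpush_difS.
  have w1_neq q : N != q -> (w1 : forall p, cochain eta p) q = 0 by exact: single_cochain_neq.
  rewrite (w1_neq p.+1); last by rewrite neq_ltn ltnS Np.
  rewrite cochain_dif0 scaler0 addr0.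
  (* In degree [N.+1] the row differential of [z] cancels the top component of [y]; above it
     everything vanishes already. *)
  move: Np; rewrite leq_eqVlt => /orP[/eqP <-|Np].
    have -> : (w1 : forall p, cochain eta p) N = z by exact: single_cochainE.
    by rewrite zy subrr.
  by rewrite w1_neq ?cech_dif0 ?subr0 ?yN // neq_ltn Np.
exists (w1 + w2), x; split=> //.
- exact: (subspaceD (Rpush_gr_subspace le' pi Fsh _ _)).
- exact: (subspaceD (Rpush_fil_subspace le' pi Fsh _ _)).
by rewrite (linear_propD lD) opprD addrA.
Qed.

Lemma augmentation_inj eta (x : stalk C eta) : augmentation x = 0 -> x = 0.
Proof.
move=> h; apply: sec_inj => gam hg.
have ch : is_chain le le' pi eta [ffun i : 'I_1 => gam].
  apply/andP; split; apply/forallP => i; first by rewrite ffunE.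
  by apply/forallP => j; apply/implyP => _; rewrite !ffunE.
pose s : chain eta 0 := Sub _ ch.
have <- : last_cone s = gam by rewrite /last_cone /= ffunE.
by have := congr1 (fun f : Rpush_stalk le le' pi F eta => f 0%N s) h.
Qed.

(** Up to a total coboundary, a bounded cochain whose differential vanishes in positive Cech degrees
    is an augmentation; injectivity of the augmentation then carries the cocycle and coboundary
    equations back to [C]. *)
Lemma augmentation_quasi_iso lam :
  quasi_iso_on_fil (F := C) (F' := Rpush le le' pi F) augmentation lam.
Proof.
move=> eta del.
have lD := @Rpush_dif_linear _ _ _ _ _ le' pi _ Fsh eta.
have lk := @augmentation_linear eta.
(* The component in Cech degree p has internal degree e - p, hence is 0 once p exceeds e. *)
have bounded (e : R) (y : Rpush_stalk le le' pi F eta) : @Rpush_gr K R T le T' le' pi F eta e y ->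
    exists N, forall p, (N < p)%N -> (y : forall p, cochain eta p) p = 0.
  move=> gry; exists (Num.bound e) => p Np; apply: functional_extensionality_dep => s.
  apply: gr_neg (gry p s); rewrite subr_lt0.
  have e1 : e < (Num.bound e)%:R.
    have [e0|e0] := leP 0 e; first exact: archi_boundP.
    exact: lt_le_trans e0 (ler0n _ _).
  by apply: lt_trans e1 _; rewrite ltr_nat.
split.
- move=> x [grx filx dx] [y [gry fily yx]].
  have [N yN] := bounded _ _ gry.
  have dy p : @Rpush_dif K R T le T' le' pi F eta y p.+1 = 0.
    by rewrite (_ : Rpush_dif y = augmentation x).
  have [w [x' [grw filw grx' filx' e]]] := total_reduction gry fily dy yN.
  (* The reduced cochain differs from [y] by a coboundary, so it has the same differential, namely
     the augmentation of [x]. *)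
  exists x'; split=> //; apply/eqP; rewrite -subr_eq0; apply/eqP; apply: augmentation_inj.
  rewrite (linear_propD lk) (linear_propN lk) augmentation_dif -e.
  by rewrite (linear_propD lD) (linear_propN lD) (Rpush_dif_dif Fsh) subr0 -[X in _ - X]yx subrr.
- move=> y [gry fily dy].
  have [N yN] := bounded _ _ gry.
  have dy' p : @Rpush_dif K R T le T' le' pi F eta y p.+1 = 0.
    by rewrite (_ : Rpush_dif y = 0).
  have [w [x [grw filw grx filx e]]] := total_reduction gry fily dy' yN.
  exists x; last by exists w; split=> //; rewrite -e opprB addrC subrK.
  split=> //; apply: augmentation_inj.
  by rewrite augmentation_dif -e (linear_propD lD) (linear_propN lD) (Rpush_dif_dif Fsh) subr0.
Qed.

End Augmentation.

(** * Comparison *)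

Section OrthogonalityFan.
Variables (R : realType) (d : nat) (S S' : stacky_fan R d).
Implicit Types (eta gam : ofan S S').

Lemma pM_cones eta : pM eta \in cones S. Proof. exact: fsvalP. Qed.

Lemma pN_cones eta : pN eta \in cones S'. Proof. exact: fsvalP. Qed.

Lemma ofan_orthogonal eta : orthogonal (pM eta) (pN eta).
Proof. exact/asboolP/(valP eta). Qed.

Lemma ofan_exists c c' : c \in cones S -> c' \in cones S' -> orthogonal c c' ->
  exists eta, pM eta = c /\ pN eta = c'.
Proof.
move=> cS c'S cc'.
pose p : cones S * cones S' := ([` cS]%fset, [` c'S]%fset).
have h : `[< orthogonal (val p.1) (val p.2) >] by exact/asboolP.
by exists (exist _ p h).
Qed.

Lemma ofan_inj eta gam : pM eta = pM gam -> pN eta = pN gam -> eta = gam.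
Proof.
move=> hM hN; apply: val_inj; apply: injective_projections; exact: val_inj.
Qed.

Lemma ofaceP gam eta :
  reflect (pM gam `<=` pM eta /\ pN gam `<=` pN eta) (oface gam eta).
Proof.
apply: (iffP (asboolP _)) => -[h h']; split.
- exact: face_sub h.
- exact: face_sub h'.
- exact: (cones_sub_face (pM_cones _) (pM_cones _)).
- exact: (cones_sub_face (pN_cones _) (pN_cones _)).
Qed.

Lemma oface_refl : reflexive (@oface R d S S').
Proof. by move=> eta; apply/ofaceP; split. Qed.

Lemma oface_trans : transitive (@oface R d S S').
Proof.
move=> a b c /ofaceP[h1 h1'] /ofaceP[h2 h2']; apply/ofaceP.
by split; [apply: subset_trans h2|apply: subset_trans h2'].
Qed.

End OrthogonalityFan.

(** * Degrees and filtration on the de Rham complexes *)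

Section DeRhamSheaf.
Variables (R : realType) (d : nat) (S S' G G' : stacky_fan R d) (gc g : laurent R d).
Local Notation idx := ('rV[int]_d * 'rV[int]_d * {set 'I_d})%type.
Local Notation dRc := (dR_complex S S' G G' gc g).
Hypotheses (lqg : log_Q_Gorenstein S) (lqg' : log_Q_Gorenstein S').
Hypothesis gc_one : forall c u, c \in cones S -> u \in msupp gc -> c (latv R u) ->
  height S (latv R u) = 1.
Hypothesis g_one : forall c v, c \in cones S' -> v \in msupp g -> c (latv R v) ->
  height S' (latv R v) = 1.

Lemma supp_subspace (c c' : set 'rV[R]_d) (P : idx -> Prop) :
  subspace [set x : face_tensor c c' | forall z, coef x z != 0 -> P z].
Proof.
split=> [z|k x y Px Py z]; first by rewrite coef0 eqxx.
rewrite coef_linear.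
have [x0|/Px//] := eqVneq (coef x z) 0; have [y0|/Py//] := eqVneq (coef y z) 0.
by rewrite x0 y0 mulr0 addr0 eqxx.
Qed.

Lemma dR_grP eta del (x : stalk dRc eta) :
  gr del x <-> (forall z, coef x z != 0 -> degN S S' z = del).
Proof. exact: (msupp_coefP x (fun z => degN S S' z = del)). Qed.

Lemma dR_filP eta lam (x : stalk dRc eta) :
  fil lam x <-> (forall z, coef x z != 0 -> lam <= aweight S S' z).
Proof. exact: (msupp_coefP x (fun z => lam <= aweight S S' z)). Qed.

Lemma dR_dif_supp eta (x : stalk dRc eta) (P Q : idx -> Prop) :
    (forall m n (J K : {set 'I_d}) u, pM eta (latv R m) -> pM eta (latv R u) ->
       u \in msupp gc -> #|J| = #|K|.+1 -> P (m, n, J) -> Q (u + m, n, K)) ->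
    (forall m n (J K : {set 'I_d}) v, pN eta (latv R n) -> pN eta (latv R v) ->
       v \in msupp g -> #|K| = #|J|.+1 -> P (m, n, J) -> Q (m, v + n, K)) ->
    (forall m n (J K : {set 'I_d}), #|K| = #|J|.+1 -> P (m, n, J) -> Q (m, n, K)) ->
    (forall z, coef x z != 0 -> P z) ->
  forall z, coef (dif x : stalk dRc eta) z != 0 -> Q z.
Proof.
move=> QA QB QE Px; have [Q0 QD] := supp_subspace (pM eta) (pN eta) Q.
apply: (lin_ext_supp (P := P)
  (Q := fun x : face_tensor (pM eta) (pN eta) => forall z, coef x z != 0 -> Q z)) => //.
move=> [[m n] J] /in_conesP[/= cm cn] Pz; apply: dR_dif_mono_supp.
- by move=> u K us cu JK; apply: (QA m n J).
- by move=> v K vs cv JK; apply: (QB m n J).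
- by move=> K JK; apply: (QE m n J).
Qed.

(** With exponents of height 1, contraction lowers k and raises psi(m) by 1, while the wedge by v
    raises k and psi'(n), the height over [S'], by 1: a is unchanged and k + 2 psi(m) grows by 1.
    The wedge by n raises both by 1. *)
Lemma dR_complex_is_fcx_sheaf : is_fcx_sheaf (@oface R d S S') dRc.
Proof.
split.
- by move=> a b _; apply: truncate_linear.
- by move=> a x; apply: truncate_id.
- by move=> a b c x _ /ofaceP[h h']; apply: truncate_truncate.
- by move=> a; apply: lin_ext_linear.
- move=> a x; apply: dR_dif_dif; last exact: ofan_orthogonal.
    by move=> u v; apply: (coneD (pM_cones a)).
  by move=> u v; apply: (coneD (pN_cones a)).
- move=> a b x /asboolP[h h']; apply/esym; apply: truncate_dR_dif.
  + exact: face_sub h.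
  + exact: face_sub h'.
  + by move=> c _; apply: face_restrict.
  + by move=> c _; apply: face_restrict.
- move=> a del; split; first by apply/dR_grP => z; rewrite coef0 eqxx.
  move=> k x y /dR_grP hx /dR_grP hy; apply/dR_grP.
  by case: (supp_subspace (pM a) (pN a) (fun z => degN S S' z = del)) => _; apply.
- move=> a b del x _ /dR_grP hx; apply/dR_grP => z; rewrite coef_truncate.
  by case: ifP => _; [apply: hx|rewrite eqxx].
- move=> a del x /dR_grP hx; apply/dR_grP.
  apply: (dR_dif_supp (P := fun z => degN S S' z = del)) hx; rewrite /degN /aweight /rweight /=.
  + move=> m n J K u cm cu us JK <-.
    rewrite latvD (heightD lqg (pM_cones a)) // (gc_one (pM_cones a)) // JK -natr1.
    by ring.
  + move=> m n J K v cn cv vs JK <-.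
    rewrite latvD (heightD lqg' (pN_cones a)) // (g_one (pN_cones a)) // JK -natr1.
    by ring.
  + by move=> m n J K JK <-; rewrite JK -natr1; ring.
- move=> a lam; split; first by apply/dR_filP => z; rewrite coef0 eqxx.
  move=> k x y /dR_filP hx /dR_filP hy; apply/dR_filP.
  by case: (supp_subspace (pM a) (pN a) (fun z => lam <= aweight S S' z)) => _; apply.
- move=> a lam mu lm x /dR_filP hx; apply/dR_filP => z /hx.
  exact: le_trans.
- move=> a b lam x _ /dR_filP hx; apply/dR_filP => z; rewrite coef_truncate.
  by case: ifP => _; [apply: hx|rewrite eqxx].
- move=> a lam x /dR_filP hx; apply/dR_filP.
  apply: (dR_dif_supp (P := fun z => lam <= aweight S S' z)) hx; rewrite /aweight /=.
  + move=> m n J K u cm cu us ->.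
    rewrite -natr1 latvD (heightD lqg (pM_cones a)) // => h.
    by rewrite (gc_one (pM_cones a)) //; lra.
  + move=> m n J K v cn cv vs ->.
    rewrite -natr1 latvD (heightD lqg' (pN_cones a)) // => h.
    by rewrite (g_one (pN_cones a)) //; lra.
  + by move=> m n J K ->; rewrite -natr1; lra.
Qed.

Lemma degN_ge0 (eta : ofan S S') z : in_cones (pM eta) (pN eta) z -> 0 <= degN S S' z.
Proof.
move=> /in_conesP[zM _]; have hM := height_ge0 lqg (pM_cones eta) zM.
have hJ : 0 <= #|z.2|%:R :> R by rewrite ler0n.
by rewrite /degN /aweight /rweight; lra.
Qed.

End DeRhamSheaf.

Section ChainSnoc.
Variables (T : finType) (le : rel T) (T' : finType) (le' : rel T') (pi : T -> T').
Local Notation chain := (chain le le' pi).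

(** Chains descend, so the appended cone becomes the last and smallest; under the guard, [inord i]
    has the value of i. *)
Definition snoc_ffun p (s : {ffun 'I_p.+1 -> T}) (t : T) : {ffun 'I_p.+2 -> T} :=
  [ffun i : 'I_p.+2 => if (i < p.+1)%N then s (inord i) else t].

Hypothesis le_refl : reflexive le.
Hypothesis le_trans : transitive le.

Lemma chain_snoc eta p (s : chain eta p) t : le t (last_cone s) -> le' (pi t) eta ->
  exists u : chain eta p.+1, val u = snoc_ffun (val s) t.
Proof.
move=> ts te; suff h : is_chain le le' pi eta (snoc_ffun (val s) t) by exists (Sub _ h).
apply/andP; split; apply/forallP => i.
  by rewrite ffunE; case: ifP => // _; apply: (chain_in s).
apply/forallP => j; apply/implyP => ij; rewrite !ffunE.
case: (ltnP j p.+1) => jp; last first.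
  case: (ltnP i p.+1) => ip //; apply: le_trans ts _.
  by apply: (chain_le s); apply: leq_ord.
have ip := leq_ltn_trans ij jp; rewrite ip.
by apply: (chain_le s); rewrite !inordK.
Qed.

Section Snoc.
Variables (eta : T') (p : nat) (s : chain eta p) (t : T) (u : chain eta p.+1).
Hypothesis us : val u = snoc_ffun (val s) t.

Lemma last_cone_snoc : last_cone u = t.
Proof. by rewrite /last_cone us ffunE ltnn. Qed.

Lemma chain_omit_snoc_last : chain_omit u ord_max = s.
Proof.
apply: val_inj; apply/ffunP => k; rewrite /= ffunE us ffunE lift_max ltn_ord.
by congr (val s _); apply: val_inj; rewrite /= inordK // lift_max.
Qed.

End Snoc.

Lemma chain_omit_snoc eta p (s : chain eta p.+1) t (u : chain eta p.+2) (i : 'I_p.+2) :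
  val u = snoc_ffun (val s) t ->
  val (chain_omit u (widen_ord (leqnSn _) i)) = snoc_ffun (val (chain_omit s i)) t.
Proof.
move=> us; apply/ffunP => k; rewrite /= !ffunE us ffunE /=.
have ip := ltn_ord i; have kp := ltn_ord k.
have -> : (bump i k < p.+2)%N = (k < p.+1)%N.
  by rewrite /bump; case: (leqP i k) => ik; lia.
case: ifP => // kp1; congr (val s _); apply: val_inj.
rewrite /= !inordK //= /bump; case: (leqP i k) => ik; lia.
Qed.

Lemma chain_omit_snoc0 eta (s : chain eta 0) t (u : chain eta 1) :
  val u = snoc_ffun (val s) t -> val (chain_omit u ord0) = [ffun=> t].
Proof. by move=> us; apply/ffunP => k; rewrite /= !ffunE us ffunE /=. Qed.

End ChainSnoc.

(** * Exactness of the augmented Godement rows *)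

Section RowExactness.
Variables (R : realType) (d : nat) (S S' G G' : stacky_fan R d) (gc g : laurent R d).
Variable pi : ofan G G' -> ofan S S'.
Local Notation idx := ('rV[int]_d * 'rV[int]_d * {set 'I_d})%type.
Local Notation F := (dR_complex G G' G G' gc g).
Local Notation C := (dR_complex S S' G G' gc g).
Local Notation chain := (chain (@oface R d G G') (@oface R d S S') pi).
Local Notation cochain := (cochain (@oface R d G G') (@oface R d S S') pi F).
Implicit Types (z : idx) (gam mu nu : ofan G G') (eta : ofan S S').

Definition in_ofan (A A' : stacky_fan R d) (gam : ofan A A') z : bool :=
  in_cones (pM gam) (pN gam) z.

Definition min_cone z mu : bool :=
  `[< in_ofan mu z /\ forall nu, in_ofan nu z -> oface mu nu >].

Definition scoef gam (x : stalk F gam) z : R[i] := @coef R d (pM gam) (pN gam) x z.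

Lemma scoefP gam (x y : stalk F gam) : (forall z, in_ofan gam z -> scoef x z = scoef y z) -> x = y.
Proof.
move=> h; apply: (@coefP R d (pM gam) (pN gam)) => z.
have [hz|hz] := boolP (in_ofan gam z); first exact: h.
by rewrite !coef_out.
Qed.

Lemma scoef_res gam nu (x : stalk F gam) z : in_ofan nu z ->
  scoef (res nu x : stalk F nu) z = scoef x z.
Proof. by rewrite /scoef coef_truncate /in_ofan => ->. Qed.

Lemma min_cone_unique z mu nu : min_cone z mu -> min_cone z nu -> mu = nu.
Proof.
move=> /asboolP[m1 m2] /asboolP[n1 n2].
have /ofaceP[h1 h1'] := m2 _ n1; have /ofaceP[h2 h2'] := n2 _ m1.
by apply: ofan_inj; apply/seteqP; split.
Qed.

(* The element whose coefficient at z is that of v at the smallest cone       *)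
(* containing z.                                                              *)
Definition assemble c c' (v : forall gam, stalk F gam) : face_tensor c c' :=
  \sum_(gam : ofan G G')
    lin_ext (fun z => if min_cone z gam then mono c c' z else 0)
      (v gam : face_tensor (pM gam) (pN gam)).

Lemma coef_assemble c c' (v : forall gam, stalk F gam) z mu : min_cone z mu ->
  coef (assemble c c' v) z = if in_cones c c' z then scoef (v mu) z else 0.
Proof.
move=> zmu; rewrite /assemble coef_sum (bigD1 mu) //= big1 ?addr0 => [|gam ne].
  by rewrite (coef_lin_ext_filter (min_cone^~ mu)) zmu.
rewrite (coef_lin_ext_filter (min_cone^~ gam)); case: ifP => // /andP[zg _].
by rewrite (min_cone_unique zmu zg) eqxx in ne.
Qed.

Hypothesis pi_le : forall gam eta, oface (pi gam) eta <->
  pM gam `<=` pM eta /\ pN gam `<=` pN eta.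
Hypothesis min_exists : forall eta z, in_ofan eta z ->
  exists2 mu, min_cone z mu & oface (pi mu) eta.

(* When the chain f gam ends in gam, the restriction only replaces a          *)
(* transport along [last_cone u = gam].                                       *)
Definition extend eta p (y : cochain eta p) (f : ofan G G' -> {ffun 'I_p.+1 -> ofan G G'}) gam :
    stalk F gam :=
  if insub (f gam) is Some u then res gam (y u) else 0.

Lemma scoef_extend eta p (y : cochain eta p) f gam (u : chain eta p) z :
  val u = f gam -> in_ofan gam z -> scoef (extend y f gam) z = scoef (y u) z.
Proof.
move=> uf hz; rewrite /extend; case: insubP => [u' _ u'E|]; last by rewrite -uf (valP u).
have -> : u' = u by apply: val_inj; rewrite u'E.
exact: scoef_res.
Qed.

Lemma extend_supp eta p (y : cochain eta p) f gam (P : idx -> Prop) :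
  (forall u z, scoef (y u) z != 0 -> P z) ->
  forall z, scoef (extend y f gam) z != 0 -> P z.
Proof.
move=> Py z; rewrite /extend; case: insubP => [u _ _|_]; last by rewrite /scoef coef0 eqxx.
rewrite /scoef coef_truncate; case: ifP => _; last by rewrite eqxx.
exact: Py.
Qed.

Lemma scoef_cech eta p (y : cochain eta p) (s : chain eta p.+1) z : in_ofan (last_cone s) z ->
  scoef (cech_dif y s) z = \sum_(i < p.+2) (-1) ^+ i * scoef (y (chain_omit s i)) z.
Proof.
move=> hz; rewrite /scoef /cech_dif coef_sum; apply: eq_bigr => i _.
by rewrite coefZ; congr (_ * _); apply: scoef_res.
Qed.

Lemma in_last_min eta p (s : chain eta p) z : in_ofan (last_cone s) z ->
  exists mu, [/\ min_cone z mu, in_ofan mu z, oface mu (last_cone s) & oface (pi mu) eta].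
Proof.
move=> hz; have /pi_le[h h'] := chain_last_in s.
have [mu zmu mueta] := min_exists (in_cones_sub h h' hz).
by exists mu; have /asboolP[m1 m2] := zmu; split=> //; apply: m2.
Qed.

(* The rows are contracted by appending to a chain the smallest cone          *)
(* containing the monomial whose coefficient is considered.                   *)
Lemma cech_exact0_dR eta (y : cochain eta 0) : cech_dif y = 0 ->
  exists x : stalk C eta,
    (forall s : chain eta 0, y s = truncate (pM (last_cone s)) (pN (last_cone s)) x) /\
    (forall P : idx -> Prop, (forall s z, scoef (y s) z != 0 -> P z) ->
       forall z, coef x z != 0 -> P z).
Proof.
move=> cy; pose f gam : {ffun 'I_1 -> ofan G G'} := [ffun=> gam].
pose x : face_tensor (pM eta) (pN eta) := assemble (pM eta) (pN eta) (extend y f).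
exists x; split=> [s|P Py z]; last first.
  have [hz|hz] := boolP (in_ofan eta z); last by rewrite coef_out ?eqxx.
  have [mu zmu _] := min_exists hz.
  by rewrite (coef_assemble _ _ _ zmu) ifT //; apply: extend_supp.
apply: scoefP => z hz.
have [mu [zmu hmu mus mueta]] := in_last_min hz.
have [u us] := chain_snoc (@oface_refl _ _ _ _) (@oface_trans _ _ _ _) mus mueta.
have hu : in_ofan (last_cone u) z by rewrite (last_cone_snoc us).
(* The cocycle condition on the chain (s, mu) says that y(s) and y(mu) have the same coefficient at
   z. *)
have := scoef_cech y hu; rewrite cy.
rewrite /scoef coef0 !big_ord_recl big_ord0 /= expr0 mul1r addr0 expr1 mulN1r.
rewrite (_ : lift ord0 ord0 = ord_max :> 'I_2); last exact: val_inj.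
rewrite (chain_omit_snoc_last us) => /esym/eqP; rewrite subr_eq0 => /eqP <-.
rewrite coef_truncate ifT // (coef_assemble _ _ _ zmu) ifT; last first.
  by have /pi_le[h h'] := chain_last_in s; apply: in_cones_sub hz.
apply/esym; apply: scoef_extend => //.
exact: chain_omit_snoc0 us.
Qed.

(** The primitive at a chain s has, at z, the coefficient of y at s extended by the smallest cone of
    z, up to the sign (-1)^(p+1). The arbitrary predicate [P] on supports later yields degree and
    filtration together. *)
Lemma cech_exactS_dR eta p (y : cochain eta p.+1) : cech_dif y = 0 ->
  exists x : cochain eta p, cech_dif x = y /\
    (forall P : idx -> Prop, (forall s z, scoef (y s) z != 0 -> P z) ->
       forall s z, scoef (x s) z != 0 -> P z).
Proof.
move=> cy.
pose v p (s : chain eta p) (y : cochain eta p.+1) := extend y (snoc_ffun (val s)).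
pose x : cochain eta p := fun s => ((-1) ^+ p.+1 : R[i]) *:
  (assemble (pM (last_cone s)) (pN (last_cone s)) (v p s y) : stalk F (last_cone s)).
have xE s z mu : min_cone z mu -> in_ofan (last_cone s) z ->
    scoef (x s) z = (-1) ^+ p.+1 * scoef (v p s y mu) z.
  by move=> zmu hz; rewrite /scoef coefZ (coef_assemble _ _ _ zmu) ifT.
exists x; split=> [|P Py s z]; last first.
  have [hz|hz] := boolP (in_ofan (last_cone s) z); last by rewrite /scoef coef_out ?eqxx.
  have [mu [zmu hmu mus mueta]] := in_last_min hz.
  rewrite (xE _ _ _ zmu hz) mulf_eq0 negb_or => /andP[_].
  exact: extend_supp.
apply: functional_extensionality_dep => s; apply: scoefP => z hz.
have [mu [zmu hmu mus mueta]] := in_last_min hz.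
have [u us] := chain_snoc (@oface_refl _ _ _ _) (@oface_trans _ _ _ _) mus mueta.
have hu : in_ofan (last_cone u) z by rewrite (last_cone_snoc us).
rewrite scoef_cech //.
have := scoef_cech y hu; rewrite cy.
rewrite {1}/scoef coef0 big_ord_recr /= (chain_omit_snoc_last us) => /esym/eqP.
rewrite addr_eq0 => /eqP hs.
(* Appending the smallest cone commutes with omitting a cone of s, so the differential of the
   primitive is the cocycle sum over the extended chain without its last term. *)
transitivity ((-1) ^+ p.+1 * \sum_(i < p.+2) (-1) ^+ i *
    scoef (y (chain_omit u (widen_ord (leqnSn _) i))) z).
  rewrite mulr_sumr; apply: eq_bigr => i _.
  have hzi : in_ofan (last_cone (chain_omit s i)) z.
    have /ofaceP[h h'] := chain_omit_le s i; exact: in_cones_sub hz.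
  rewrite (xE _ _ _ zmu hzi) mulrCA; congr (_ * (_ * _)).
  apply: scoef_extend => //.
  exact: chain_omit_snoc us.
rewrite hs [(-1) ^+ p.+2]exprS mulN1r mulNr opprK mulrA -exprD addnn -mul2n exprM.
by rewrite sqrrN !expr1n mul1r.
Qed.

End RowExactness.

(** The smallest cone t lies in some s of [S]; its intersection with the common face of s and [c] is
    a face of t containing x, hence all of t. *)
Lemma subdivision_smallest (R : realType) (d : nat) (S G : stacky_fan R d) c x :
    subdivision G S -> c \in cones S -> c x ->
  exists2 t, smallest_cone G [set x] t & t `<=` c.
Proof.
move=> [supp ref _] cS cx.
have [e eG ex] : fsupport G x by rewrite supp; exists c.
have [|t [tG xt tmin]] := smallest_cone_exists eG (A := [set x]).
  by move=> _ ->.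
exists t; first by split.
have [s sS ts] := ref t tG.
have fc := face_restrict (cones_face_setI sS cS) ts.
apply: subset_trans (tmin _ (face_cones tG fc) _) _.
  by move=> _ ->; split; [apply: xt|split=> //; apply/ts/xt].
by move=> y [_ []].
Qed.

Theorem theorem3p5 (R : realType) (d : nat)
    (S S' G G' : stacky_fan R d) (f f' g g' gh gh' : laurent R d)
    (hmirror : mirror_pair S f S' f')
    (hg : height_one_rep g (Ppoly S'))
    (hg' : height_one_rep g' (Ppoly S))
    (hG : LG_subdivision G gh S g) (hGc : crepant G S)
    (hG' : LG_subdivision G' gh' S' g') (hGc' : crepant G' S') :
  exists pi : ofan G G' -> ofan S S',
    let C := dR_complex S S' G G' g' g in
    let Ch := dR_complex G G' G G' gh' gh in
    let RpiCh := Rpush (@oface R d G G') (@oface R d S S') pi Ch in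
    let kappa := @dR_canonical R d S S' G G' g' g gh' gh pi in
    [/\ is_subdivision_map pi /\
          (forall gam eta, oface gam eta -> oface (pi gam) (pi eta)),
        is_fcx_sheaf (@oface R d S S') C,
        is_fcx_sheaf (@oface R d G G') Ch /\
          is_fcx_sheaf (@oface R d S S') RpiCh,
        is_filtered_morphism (@oface R d S S') kappa &
        forall lam : R, quasi_iso_on_fil kappa lam].
Proof.
have [[_ lqgS _ regS] [_ lqgS' _ _] _ PS'] := hmirror.
have [subG [_ lqgG _ _] _ ghE] := hG.
have [subG' [_ lqgG' _ _] _ ghE'] := hG'.
subst gh gh'.
have [_ refG _] := subG; have [_ refG' _] := subG'.
have heightG c x : c \in cones G -> c x -> height G x = height S x.
  by move=> cG cx; apply: height_crepant cG cx.
have heightG' c x : c \in cones G' -> c x -> height G' x = height S' x.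
  by move=> cG cx; apply: height_crepant cG cx.
have oneS c u : c \in cones S -> u \in msupp g' -> c (latv R u) -> height S (latv R u) = 1.
  by move=> cS us cu; apply: height_one hg' us cS cu.
have oneS' c u : c \in cones S' -> u \in msupp g -> c (latv R u) -> height S' (latv R u) = 1.
  by move=> cS us cu; apply: height_one hg us cS cu.
have oneG c u : c \in cones G -> u \in msupp g' -> c (latv R u) -> height G (latv R u) = 1.
  move=> cG us cu; have [s sS cs] := refG c cG.
  by rewrite (heightG c) // (oneS s) //; apply: cs.
have oneG' c u : c \in cones G' -> u \in msupp g -> c (latv R u) -> height G' (latv R u) = 1.
  move=> cG us cu; have [s sS cs] := refG' c cG.
  by rewrite (heightG' c) // (oneS' s) //; apply: cs.
have pos c c' x y : c \in cones S -> c' \in cones S' -> c x -> c' y -> 0 <= pairing x y.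
  exact: mirror_pairing_ge0 regS PS'.
have /choice[pi piP] (eta : ofan G G') : exists nu : ofan S S',
    smallest_cone S (pM eta) (pM nu) /\ smallest_cone S' (pN eta) (pN nu).
  have [s sS es] := refG _ (pM_cones eta); have [s' s'S es'] := refG' _ (pN_cones eta).
  have [t tP] := smallest_cone_exists sS es; have [t' tP'] := smallest_cone_exists s'S es'.
  have [tS _ _] := tP; have [tS' _ _] := tP'.
  have [nu [nuM nuN]] :=
    ofan_exists tS tS' (orthogonal_smallest pos (ofan_orthogonal (eta := eta)) tP tP').
  by exists nu; rewrite nuM nuN.
(* Minimality of the cones of [pi gam] describes the open set over [eta]: it consists of the pairs
   contained in [eta]. *)
have pi_le gam eta : oface (pi gam) eta <-> pM gam `<=` pM eta /\ pN gam `<=` pN eta.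
  have [[_ gs smin] [_ gs' smin']] := piP gam.
  split=> [/ofaceP[h h']|[h h']].
    by split; [apply: subset_trans h|apply: subset_trans h'].
  by apply/ofaceP; split; [apply: smin h; apply: pM_cones|apply: smin' h'; apply: pN_cones].
have min_exists eta z : in_ofan eta z ->
    exists2 mu : ofan G G', min_cone z mu & oface (pi mu) eta.
  move=> /in_conesP[zM zN].
  have [t [tG zt tmin] te] := subdivision_smallest subG (pM_cones eta) zM.
  have [t' [tG' zt' tmin'] te'] := subdivision_smallest subG' (pN_cones eta) zN.
  (* Orthogonality is inherited from [eta], whose components contain t and t'. *)
  have tt' : orthogonal t t'.
    by move=> x y tx ty; apply: (ofan_orthogonal (eta := eta)); [apply: te|apply: te'].
  have [mu [muM muN]] := ofan_exists tG tG' tt'.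
  exists mu; last by apply/pi_le; rewrite muM muN.
  apply/asboolP; split.
    by apply/in_conesP; rewrite muM muN; split; [apply: zt|apply: zt'].
  move=> nu /in_conesP[nuM nuN]; apply/ofaceP; rewrite muM muN; split.
    by apply: tmin; [apply: pM_cones|move=> _ ->].
  by apply: tmin'; [apply: pN_cones|move=> _ ->].
have degE (gam : ofan G G') z : in_ofan gam z -> degN G G' z = degN S S' z.
  move=> /in_conesP[zM zN]; rewrite /degN /aweight /rweight.
  by rewrite (heightG _ _ (pM_cones gam) zM) (heightG' _ _ (pN_cones gam) zN).
have aweightE (gam : ofan G G') z : in_ofan gam z -> aweight G G' z = aweight S S' z.
  move=> /in_conesP[zM zN]; rewrite /aweight.
  by rewrite (heightG _ _ (pM_cones gam) zM) (heightG' _ _ (pN_cones gam) zN).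
have Csh := dR_complex_is_fcx_sheaf G G' lqgS lqgS' oneS oneS'.
have Fsh := dR_complex_is_fcx_sheaf G G' lqgG lqgG' oneG oneG'.
have Rsh := Rpush_is_fcx_sheaf pi Fsh (@oface_refl _ _ _ _) (@oface_trans _ _ S S').
exists pi => C Ch RpiCh kappa.
pose sec eta (x : stalk C eta) (gam : ofan G G') : stalk Ch gam :=
  truncate (pM gam) (pN gam) x.
have sec_linear eta gam : linear (fun x : stalk C eta => sec eta x gam).
  exact: truncate_linear.
have sec_face eta (x : stalk C eta) gam gam' : oface (pi gam) eta ->
    oface gam' gam -> res gam' (sec eta x gam) = sec eta x gam'.
  by move=> _ /ofaceP[h h']; apply: truncate_truncate.
have sec_res eta eta' (x : stalk C eta) gam : oface eta' eta ->
    oface (pi gam) eta' -> sec eta' (res eta' x) gam = sec eta x gam.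
  by move=> _ /pi_le[h h']; apply: truncate_truncate.
have sec_dif eta (x : stalk C eta) gam : oface (pi gam) eta ->
    sec eta (dif x) gam = dif (sec eta x gam).
  (* The cones of [gam] need not be faces of those of [eta]; it suffices that they meet the cones of
     [G] and [G'] in faces. *)
  move=> /pi_le[h h']; apply: truncate_dR_dif => // b bG _.
    exact: (cones_face_setI bG (pM_cones gam)).
  exact: (cones_face_setI bG (pN_cones gam)).
have sec_gr eta del (x : stalk C eta) gam : oface (pi gam) eta ->
    gr del x -> gr del (sec eta x gam).
  move=> _ /dR_grP hx; apply/dR_grP => z; rewrite coef_truncate.
  by case: ifP => [hz /hx <-|]; [apply: degE hz|rewrite eqxx].
have sec_fil eta lam (x : stalk C eta) gam : oface (pi gam) eta ->
    fil lam x -> fil lam (sec eta x gam).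
  move=> _ /dR_filP hx; apply/dR_filP => z; rewrite coef_truncate.
  by case: ifP => [hz /hx|]; [rewrite (aweightE gam)|rewrite eqxx].
have sec_inj eta (x : stalk C eta) :
    (forall gam, oface (pi gam) eta -> sec eta x gam = 0) -> x = 0.
  move=> h; apply: coefP => z; rewrite coef0.
  have [hz|hz] := boolP (in_ofan eta z); last by rewrite coef_out.
  have [mu /asboolP[zmu _] /h mu0] := min_exists _ _ hz.
  by have := coef_truncate (pM mu) (pN mu) x z; rewrite -/(sec eta x mu) mu0 coef0 ifT.
have gr_neg gam (del : R) (x : stalk Ch gam) : del < 0 -> gr del x -> x = 0.
  move=> del0 /dR_grP hx; apply: coefP => z; rewrite coef0.
  have [hz|hz] := boolP (in_ofan gam z); last by rewrite coef_out.
  have [//|/hx zdel] := eqVneq (coef x z) 0.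
  by move: del0; rewrite -zdel ltNge (degN_ge0 lqgG hz).
have exact0 eta del lam (y : cochain (@oface R d G G') (@oface R d S S') pi Ch eta 0) :
    (forall s, gr del (y s)) -> (forall s, fil lam (y s)) -> cech_dif y = 0 ->
  exists x : stalk C eta, [/\ gr del x, fil lam x & forall s, y s = sec eta x (last_cone s)].
  move=> gry fily cy.
  have [x [yx xP]] := cech_exact0_dR pi_le min_exists cy.
  exists x; split=> //.
    apply/dR_grP; apply: (xP (fun z => degN S S' z = del)) => s z yz.
    have /dR_grP/(_ _ yz) <- := gry s.
    (* The two degrees agree on monomials of the last cone, and all other coefficients are 0. *)
    apply/esym/(degE (last_cone s)); apply: contraR yz => hz.
    by rewrite /scoef coef_out.
  apply/dR_filP; apply: (xP (fun z => lam <= aweight S S' z)) => s z yz.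
  have /dR_filP/(_ _ yz) := fily s.
  rewrite (aweightE (last_cone s)) //; apply: contraR yz => hz.
  by rewrite /scoef coef_out.
have exactS eta p del lam (y : cochain (@oface R d G G') (@oface R d S S') pi Ch eta p.+1) :
    (forall s, gr del (y s)) -> (forall s, fil lam (y s)) -> cech_dif y = 0 ->
  exists z : cochain (@oface R d G G') (@oface R d S S') pi Ch eta p,
    [/\ forall s, gr del (z s), forall s, fil lam (z s) & cech_dif z = y].
  move=> gry fily cy.
  have [x [yx xP]] := cech_exactS_dR pi_le min_exists cy.
  exists x; split=> // s.
    apply/dR_grP; apply: (xP (fun z => degN G G' z = del)) => t z yz.
    by have /dR_grP/(_ _ yz) := gry t.
  apply/dR_filP; apply: (xP (fun z => lam <= aweight G G' z)) => t z yz.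
  by have /dR_filP/(_ _ yz) := fily t.
have refl := @oface_refl R d G G'; have trans := @oface_trans R d S S'.
split=> //.
- split=> // gam eta /ofaceP[h h']; apply/pi_le.
  have [[_ es _] [_ es' _]] := piP eta.
  by split; [apply: subset_trans h es|apply: subset_trans h' es'].
- exact: (augmentation_morphism Fsh refl trans sec_linear sec_face sec_res sec_dif sec_gr sec_fil).
- move=> lam.
  exact: (augmentation_quasi_iso Fsh refl trans sec_linear sec_face sec_dif sec_inj gr_neg exact0 exactS).
Qed.
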